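(* Let $y_1, y_2 \geq 2$ be integers. Then $\mathcal{W}_2(y_1)$ is isomorphic (as a complex manifold) to $\mathcal{W}_2(y_2)$ if and only if $y_1 = y_2$. Hence the family of deformations of $W_2$ whose members are obtained by gluing $U = \mathbb{C}^3_{\{z,u_1,u_2\}}$ and $V=\mathbb{C}^3_{\{\xi,v_1,v_2\}}$ along $z\neq 0$, $\xi\neq 0$ by $$(\xi, v_1, v_2) = \Bigl(z^{-1},\ z^2u_1 + \sum_{s \geq 0} t_s z u_2^s,\ u_2\Bigr),$$ with varying parameters $t_s\in\mathbb{C}$, contains infinitely many distinct isomorphism classes of complex manifolds.
   Context: $W_2 = \mathrm{Tot}(\mathcal{O}_{\mathbb{P}^1}(-2)\oplus\mathcal{O}_{\mathbb{P}^1})$ is the complex threefold obtained by gluing $U=\mathbb{C}^3_{\{z,u_1,u_2\}}$ and $V=\mathbb{C}^3_{\{\xi,v_1,v_2\}}$ by $(\xi,v_1,v_2)=(z^{-1},z^2u_1,u_2)$ for $z\ne 0$, $\xi \neq 0$. For an integer $y\geq 0$, $\mathcal{W}_2(y)$ denotes the complex threefold obtained by gluing the charts $U=\mathbb{C}^3_{\{z,u_1,u_2\}}$ and $V=\mathbb{C}^3_{\{\xi,v_1,v_2\}}$ by $(\xi,v_1,v_2)=(z^{-1},\,z^2u_1+zu_2^y,\,u_2)$ for $z\neq 0$ (so $\mathcal{W}_2(y)$ is the member of the family with $t_y=1$ and all other $t_s=0$). *)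

(* Defs.v *)
From HB Require Import structures.
From mathcomp Require Import all_boot all_order all_algebra complex generic_quotient.
From mathcomp Require Import all_classical all_reals all_analysis.
From mathcomp Require Import ring.

Set Implicit Arguments.
Unset Strict Implicit.
Unset Printing Implicit Defensive.
Import Order.TTheory GRing.Theory Num.Theory numFieldNormedType.Exports.
Local Open Scope classical_set_scope.
Local Open Scope ring_scope.
Local Open Scope complex_scope.

Definition complexField (R : realType) : numClosedFieldType := R[i].

(* Over the field R[i], [differentiable] is Frechet differentiability with a
   C-linear differential, so differentiability at every point of an open set is
   holomorphy. *)

Record complexManifold (R : realType) (n : nat) := ComplexManifold {
  carrier :> topologicalType ;
  carrier_hausdorff : hausdorff_space carrier ;
  carrier_second_countable : second_countable (T := carrier) ;
  chart_index : Type ;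
  chart_dom : chart_index -> set carrier ;
  chart : chart_index -> carrier -> 'rV[complexField R]_n ;
  chart_inv : chart_index -> 'rV[complexField R]_n -> carrier ;
  chart_dom_open : forall i, open (chart_dom i) ;
  chart_dom_cover : \bigcup_i chart_dom i = [set: carrier] ;
  chart_image_open : forall i, open (chart i @` chart_dom i) ;
  chartK : forall i p, chart_dom i p -> chart_inv i (chart i p) = p ;
  chart_continuous : forall i p, chart_dom i p ->
    {for p, continuous (chart i)} ;
  chart_inv_continuous : forall i p, chart_dom i p ->
    {for chart i p, continuous (chart_inv i)} ;
  transition_holomorphic : forall i j p, chart_dom i p -> chart_dom j p ->
    differentiable (chart j \o chart_inv i) (chart i p)
}.

(* Continuity of f makes the local expression of f meaningful near [chart i p]:
   chart maps are total functions, with irrelevant values off their domains. *)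
Definition holomorphic (R : realType) (m n : nat)
    (M : complexManifold R m) (N : complexManifold R n) (f : M -> N) : Prop :=
  continuous f /\
  forall (i : chart_index M) (j : chart_index N) (p : M),
    chart_dom i p -> chart_dom j (f p) ->
    differentiable (chart j \o f \o chart_inv i) (chart i p).

Definition isomorphic (R : realType) (m n : nat)
    (M : complexManifold R m) (N : complexManifold R n) : Prop :=
  exists (f : M -> N) (g : N -> M),
    [/\ holomorphic f, holomorphic g, cancel f g & cancel g f].

Lemma near_differentiable (K : numFieldType) (V W : normedModType K)
    (f g : V -> W) (O : set V) (x : V) :
  open O -> O x -> (forall z, O z -> f z = g z) ->
  differentiable g x -> differentiable f x.
Proof.
move=> oO Ox fgO dg.
have fg : \near x, f x = g x.
  by apply: filterS (open_nbhs_nbhs (conj oO Ox)) => z /fgO.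
 have [cg eg] := (diff_locallyP _ _).1 dg.
have fgx : f x = g x by exact: nbhs_singleton fg.
have ef : f \o shift x = cst (f x) + 'd g x +o_ 0 id.
  have fg0 : \forall h \near (0 : V), f (h + x) = g (h + x).
    by move: fg; rewrite (near_shift 0) subr0.
  apply/eqaddoP => e e0.
  have := (eqaddoP _ _ _ _).1 eg e e0; apply: filterS2 fg0 => h fgh.
  by rewrite !fctE /= fgh fgx.
by apply/diff_locallyP; rewrite (diff_unique cg ef).
Qed.

(* [gluing_graph_closed] says that the graph of the gluing map is closed in
   C^n x C^n, which is what makes the glued space Hausdorff. *)
Record gluingData (R : realType) (n : nat) := GluingData {
  gluedU : set 'rV[complexField R]_n ;
  gluedV : set 'rV[complexField R]_n ;
  gluing_map : 'rV[complexField R]_n -> 'rV[complexField R]_n ;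
  gluing_inv : 'rV[complexField R]_n -> 'rV[complexField R]_n ;
  gluedU_open : open gluedU ;
  gluedV_open : open gluedV ;
  gluing_mapUV : forall x, gluedU x -> gluedV (gluing_map x) ;
  gluing_invVU : forall x, gluedV x -> gluedU (gluing_inv x) ;
  gluing_mapK : forall x, gluedU x -> gluing_inv (gluing_map x) = x ;
  gluing_invK : forall x, gluedV x -> gluing_map (gluing_inv x) = x ;
  gluing_map_holomorphic : forall x, gluedU x -> differentiable gluing_map x ;
  gluing_inv_holomorphic : forall x, gluedV x -> differentiable gluing_inv x ;
  gluing_graph_closed : forall x y, ~ (gluedU x /\ gluing_map x = y) ->
    exists A B, [/\ open_nbhs x A, open_nbhs y B &
      forall z, A z -> gluedU z -> ~ B (gluing_map z)]
}.

Section Gluing.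
Local Open Scope quotient_scope.
Variables (R : realType) (n : nat) (D : gluingData R n).
Local Notation Cn := 'rV[complexField R]_n.

(* [true] indexes the chart U and [false] the chart V. *)
Definition in_chart (b : bool) (x : Cn) : {_ : bool & Cn} :=
  existT (fun _ => Cn) b x.

Definition glued (p q : {_ : bool & Cn}) : Prop :=
  match p, q with
  | existT true x, existT false y => gluedU D x /\ gluing_map D x = y
  | existT false y, existT true x => gluedU D x /\ gluing_map D x = y
  | existT _ x, existT _ y => x = y
  end.

Definition glued_rel : rel {_ : bool & Cn} := fun p q => `[< glued p q >].

Lemma glued_refl : reflexive glued_rel.
Proof. by case=> [[]] x; apply/asboolP. Qed.

Lemma glued_sym : symmetric glued_rel.
Proof.
move=> [[] x] [[] y]; apply/asboolP/asboolP => //=; by move=> ->.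
Qed.

Lemma glued_trans : transitive glued_rel.
Proof.
move=> [[] y] [[] x] [[] z] /asboolP /= h1 /asboolP /= h2; apply/asboolP => /=.
- by rewrite h1.
- by rewrite h1.
- by rewrite -h2.
- by case: h1 => _ <-; case: h2 => _ <-.
- case: h1 => Ux hx; case: h2 => Uz hz.
  by rewrite -(gluing_mapK Ux) hx -hz gluing_mapK.
- by rewrite -h2.
- by rewrite h1.
- by rewrite h1.
Qed.

Canonical glued_equiv := EquivRel glued_rel glued_refl glued_sym glued_trans.

Definition glued_space := quotient_topology {eq_quot glued_equiv}.

Definition glued_point (b : bool) (x : Cn) : glued_space :=
  \pi_glued_space (in_chart b x).

Definition glued_dom (b : bool) : set glued_space := range (glued_point b).

Definition glued_chart (b : bool) (p : glued_space) : Cn :=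
  xget 0 [set x | glued_point b x = p].

Lemma glued_pointE b c x y :
  glued_point b x = glued_point c y <-> glued (in_chart b x) (in_chart c y).
Proof.
split.
  move=> e; apply/asboolP.
  have : \pi_({eq_quot glued_equiv}) (in_chart b x) =
         \pi_({eq_quot glued_equiv}) (in_chart c y) by exact: e.
  by move/eqP; rewrite eqmodE.
move=> /asboolP e.
suff : \pi_({eq_quot glued_equiv}) (in_chart b x) =
       \pi_({eq_quot glued_equiv}) (in_chart c y) by [].
by apply/eqP; rewrite eqmodE.
Qed.

Lemma glued_point_inj b : injective (glued_point b).
Proof. by move=> x y /glued_pointE; case: b. Qed.

Lemma glued_point_surj p : exists b x, p = glued_point b x.
Proof.
exists (projT1 (repr p)), (projT2 (repr p)).
by rewrite /glued_point /in_chart -sigT_eta reprK.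
Qed.

Lemma glued_chartE b x : glued_chart b (glued_point b x) = x.
Proof.
by apply: xget_unique => // y /glued_point_inj.
Qed.

Lemma glued_chartK b p : glued_dom b p -> glued_point b (glued_chart b p) = p.
Proof. by case=> x _ <-; rewrite glued_chartE. Qed.

Lemma glued_point_continuous b : continuous (glued_point b).
Proof.
move=> x; apply: (@continuous_comp _ _ _ (in_chart b)).
  exact: existT_continuous.
exact: pi_continuous.
Qed.

Lemma glued_openP (A : set glued_space) :
  open A <-> forall b, open (glued_point b @^-1` A).
Proof.
split=> [oA b|oA].
  by apply: open_comp => // x _; exact: glued_point_continuous.
rewrite /open /= /quotient_open; apply/sigT_openP => b; exact: oA.
Qed.

Lemma differentiable_continuous_at (f : Cn -> Cn) x :
  differentiable f x -> {for x, continuous f}.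
Proof. exact: differentiable_continuous. Qed.

Lemma open_preimage_on (O A : set Cn) (f : Cn -> Cn) :
  open O -> (forall x, O x -> differentiable f x) -> open A ->
  open (O `&` f @^-1` A).
Proof.
move=> oO df oA; rewrite openE => x [Ox Afx].
apply: filterI; first exact: open_nbhs_nbhs.
exact: (differentiable_continuous_at (df _ Ox)) (open_nbhs_nbhs (conj oA Afx)).
Qed.

Lemma glued_point_open b (A : set Cn) : open A -> open (glued_point b @` A).
Proof.
move=> oA; apply/glued_openP => c.
have [<-|bc] := eqVneq b c.
  rewrite (_ : _ @^-1` _ = A)//; apply/seteqP; split=> x /=.
    by move=> [y Ay /glued_point_inj <-].
  by move=> Ax; exists x.
case: b bc; case: c => // _.
- rewrite (_ : _ @^-1` _ = gluedV D `&` gluing_inv D @^-1` A).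
    apply: open_preimage_on => //; first exact: gluedV_open.
    exact: gluing_inv_holomorphic.
  apply/seteqP; split=> x /=.
    move=> [y Ay /glued_pointE /= [Uy <-]]; split; first exact: gluing_mapUV.
    by rewrite gluing_mapK.
  move=> [Vx Ax]; exists (gluing_inv D x) => //; apply/glued_pointE => /=.
  by split; [exact: gluing_invVU|exact: gluing_invK].
- rewrite (_ : _ @^-1` _ = gluedU D `&` gluing_map D @^-1` A).
    apply: open_preimage_on => //; first exact: gluedU_open.
    exact: gluing_map_holomorphic.
  apply/seteqP; split=> x /=.
    by move=> [y Ay /glued_pointE /= [Ux xy]]; split; rewrite // xy.
  by move=> [Ux Ax]; exists (gluing_map D x) => //; apply/glued_pointE.
Qed.

Lemma glued_dom_open b : open (glued_dom b).
Proof. exact/glued_point_open/openT. Qed.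

Lemma glued_dom_cover : \bigcup_b glued_dom b = [set: glued_space].
Proof.
apply/seteqP; split=> // p _; have [b [x ->]] := glued_point_surj p.
by exists b => //; exists x.
Qed.

Lemma glued_chart_image b : glued_chart b @` glued_dom b = setT.
Proof.
apply/seteqP; split=> // x _; exists (glued_point b x); last exact: glued_chartE.
by exists x.
Qed.

Lemma glued_chart_image_open b : open (glued_chart b @` glued_dom b).
Proof. by rewrite glued_chart_image; exact: openT. Qed.

Lemma glued_chart_continuous b p : glued_dom b p ->
  {for p, continuous (glued_chart b)}.
Proof.
move=> [x _ <-] A; rewrite glued_chartE nbhsE /= => -[B [oB Bx] BA].
suff : nbhs (glued_point b x) (glued_chart b @^-1` A) by [].
rewrite nbhsE /=; exists (glued_point b @` B).
  by split; [exact: glued_point_open|exists x].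
by move=> _ [y By <-] /=; rewrite glued_chartE; exact: BA.
Qed.

Lemma glued_transition b c p : glued_dom b p -> glued_dom c p ->
  differentiable (glued_chart c \o glued_point b) (glued_chart b p).
Proof.
move=> [x _ <-{p}]; rewrite glued_chartE => -[y _ /glued_pointE].
have [->{c} _|bc] := eqVneq c b.
  apply: (@near_differentiable _ _ _ _ id setT) => //; first exact: openT.
  by move=> z _ /=; rewrite glued_chartE.
case: b bc; case: c => // _ /= [Ux xy].
- apply: (@near_differentiable _ _ _ _ (gluing_map D) (gluedU D)) => //.
  + exact: gluedU_open.
  + move=> z Uz /=; rewrite -[RHS](glued_chartE false); congr glued_chart.
    exact/glued_pointE.
  + exact: gluing_map_holomorphic.
- have Vx : gluedV D x by rewrite -xy; exact: gluing_mapUV.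
  apply: (@near_differentiable _ _ _ _ (gluing_inv D) (gluedV D)) => //.
  + exact: gluedV_open.
  + move=> z Vz /=; rewrite -[RHS](glued_chartE true); congr glued_chart.
    apply/glued_pointE => /=.
    by split; [exact: gluing_invVU|exact: gluing_invK].
  + exact: gluing_inv_holomorphic.
Qed.

Lemma glued_separated b c x y : glued_point b x <> glued_point c y ->
  exists A B, [/\ open_nbhs x A, open_nbhs y B &
    glued_point b @` A `&` glued_point c @` B = set0].
Proof.
have [->{c} xy|bc] := eqVneq c b.
  have /eqP xNy : x <> y by move=> e; apply: xy; rewrite e.
  have := @norm_hausdorff _ Cn; rewrite open_hausdorff => /(_ x y xNy).
  move=> [[A B] /= [xA yB] [oA oB /eqP AB0]].
  exists A, B; split.
  - by split=> //; rewrite inE in xA.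
  - by split=> //; rewrite inE in yB.
  apply/seteqP; split=> // _ [[u Au <-] [v Bv /glued_point_inj vu]].
  have : (A `&` B) u by split=> //; rewrite -vu.
  by rewrite AB0.
wlog bT : b c x y bc / b = true => [hw|].
  case: b bc => bc; first exact: (hw true c x y).
  move=> xy; have [||A [B [xA yB AB0]]] := hw c false y x _ _ (nesym xy).
  - by case: c bc {xy}.
  - by case: c bc {xy}.
  by exists B, A; split => //; rewrite setIC.
subst b; case: c bc => // _ xy.
have /gluing_graph_closed [A [B [xA yB AB]]] :
    ~ (gluedU D x /\ gluing_map D x = y).
  by move=> h; apply: xy; apply/glued_pointE.
exists A, B; split => //.
apply/seteqP; split=> // _ [[u Au <-] [v Bv /glued_pointE /= [Uu uv]]].
by apply: (AB _ Au Uu); rewrite uv.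
Qed.

Lemma glued_hausdorff : hausdorff_space glued_space.
Proof.
rewrite open_hausdorff => p q; have [b [x ->]] := glued_point_surj p.
have [c [y ->]] := glued_point_surj q => /eqP.
move=> /glued_separated [A [B [[oA Ax] [oB By] AB0]]].
exists (glued_point b @` A, glued_point c @` B) => /=.
  by split; rewrite inE; [exists x|exists y].
by split; [exact: glued_point_open|exact: glued_point_open|exact/eqP].
Qed.

Lemma glued_second_countable : second_countable (T := Cn) ->
  second_countable (T := glued_space).
Proof.
move=> [B cB [oB bB]].
exists (\bigcup_b [set glued_point b @` A | A in B]).
  apply: bigcup_countable => // b _; exact: card_le_trans (card_image_le _ _) cB.
split.
  by move=> _ [b _ [A BA <-]]; apply: glued_point_open; exact: oB.
move=> p; have [b [x ->]] := glued_point_surj p => U /glued_point_continuous.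
move=> /bB[A [BA Ax] AU]; exists (glued_point b @` A).
  by split; [exists b => //; exists A|exists x].
by move=> _ [y Ay <-]; exact: AU.
Qed.
End Gluing.

Section SecondCountable.
Variables (R : realType) (n : nat).
Local Notation C := (complexField R).

Lemma ltc_normRe (z : R[i]) (e : R) :
  `|complex.Re z| < e -> `|complex.Im z| < e -> `|z| < (e + e)%:C.
Proof.
move=> re im; rewrite {1}[z]complexE.
apply: (le_lt_trans (ler_normD _ _)).
have normi : `|'i%C| = 1 :> R[i].
  by rewrite normc_def /= expr0n /= expr1n add0r sqrtr1.
have normR (a : R) : `|a%:C| = `|a|%:C :> R[i].
  by rewrite normc_def /= expr0n /= addr0 sqrtr_sqr.
have normiR (a : R) : `|'i%C * a%:C| = `|a|%:C :> R[i].
  by rewrite normrM normi mul1r normR.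
rewrite rmorphD /=; apply: ltrD; rewrite ?normiR ?normR ltcR //.
Qed.

Lemma rat_dense_complex (z : R[i]) (e : R) : 0 < e ->
  exists q : rat * rat, `|z - (ratr q.1 +i* ratr q.2)| < e%:C.
Proof.
move=> e0; pose d := e / 2.
have d0 : 0 < d by rewrite divr_gt0.
have approx (x : R) : exists q : rat, `|x - ratr q| < d.
  have /rat_in_itvoo[q] : x - d < x + d by rewrite ltrD2l gtrN.
  by rewrite in_itv /= => qx; exists q; rewrite distrC ltr_distl.
have [q hq] := approx (complex.Re z); have [r hr] := approx (complex.Im z).
exists (q, r) => /=; rewrite [e]splitr; apply: ltc_normRe.
- by case: z hq hr.
- by case: z hq hr.
Qed.

Lemma complex_gt0P (e : C) : 0 < e -> exists2 r : R, 0 < r & e = r%:C.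
Proof.
case: e => a b; rewrite ltcE /= => /andP[/eqP -> a0].
by exists a.
Qed.

Lemma rV_second_countable : second_countable (T := 'rV[C]_n).
Proof.
pose pt (q : 'rV[rat * rat]_n) : 'rV[C]_n :=
  \row_j (ratr (q 0 j).1 +i* ratr (q 0 j).2).
pose rad (k : nat) : C := (k.+1%:R^-1 : R)%:C.
have rad_gt0 k : 0 < rad k by rewrite ltcR invr_gt0 ltr0n.
exists [set ball (pt qk.1) (rad qk.2) | qk in [set: 'rV[rat * rat]_n * nat]].
  by apply: card_le_trans (card_image_le _ _) _; exact: countableP.
split; first by move=> _ [qk _ <-]; exact: ball_open.
move=> x U /nbhs_ballP[e /complex_gt0P[r r0 ->{e}] xU].
have [k kr] : exists k, k.+1%:R^-1 + k.+1%:R^-1 < r.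
  have r20 : 0 < r / 2 by rewrite divr_gt0.
  have [k _ hk] := near_infty_natSinv_lt (PosNum r20).
  by exists k; rewrite [ltRHS]splitr; apply: ltrD; exact: (hk k (leqnn k)).
have /choice[q hq] : forall j : 'I_n, exists q : rat * rat,
    `|(x 0 j : C) - (ratr q.1 +i* ratr q.2)| < rad k.
  by move=> j; apply: rat_dense_complex; rewrite invr_gt0 ltr0n.
pose Q : 'rV[rat * rat]_n := \row_j q j.
have xQ : ball x (rad k) (pt Q).
  split => // i j; rewrite ord1 /pt !mxE.
  by rewrite -ball_normE /=; exact: hq.
exists (ball (pt Q) (rad k)).
  by split; [exists (Q, k)|exact: ball_sym].
move=> y Qy; apply: xU; apply: le_ball (ball_triangle xQ Qy).
by rewrite -rmorphD lecR ltW.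
Qed.
End SecondCountable.

Definition gluing_manifold (R : realType) (n : nat) (D : gluingData R n) :
    complexManifold R n :=
  {| carrier := glued_space D ;
     carrier_hausdorff := @glued_hausdorff R n D ;
     carrier_second_countable :=
       @glued_second_countable R n D (@rV_second_countable R n) ;
     chart_index := bool ;
     chart_dom := @glued_dom R n D ;
     chart := @glued_chart R n D ;
     chart_inv := @glued_point R n D ;
     chart_dom_open := @glued_dom_open R n D ;
     chart_dom_cover := @glued_dom_cover R n D ;
     chart_image_open := @glued_chart_image_open R n D ;
     chartK := @glued_chartK R n D ;
     chart_continuous := @glued_chart_continuous R n D ;
     chart_inv_continuous := fun b p _ =>
       @glued_point_continuous R n D b (glued_chart b p) ;
     transition_holomorphic := @glued_transition R n D |}.

Section Gluing3.
Variable R : realType.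
Local Notation C := (complexField R).
Local Notation C3 := 'rV[C]_3.

Definition vec3 (a b c : C) : C3 := \row_(j < 3) [:: a; b; c]`_j.

(* The coordinates (z, u_1, u_2), resp. (xi, v_1, v_2), of a point of C^3. *)
Definition coord0 (x : C3) : C := x 0 (inord 0).
Definition coord1 (x : C3) : C := x 0 (inord 1).
Definition coord2 (x : C3) : C := x 0 (inord 2).

Lemma coord0_vec3 a b c : coord0 (vec3 a b c) = a.
Proof. by rewrite /coord0 mxE inordK. Qed.
Lemma coord1_vec3 a b c : coord1 (vec3 a b c) = b.
Proof. by rewrite /coord1 mxE inordK. Qed.
Lemma coord2_vec3 a b c : coord2 (vec3 a b c) = c.
Proof. by rewrite /coord2 mxE inordK. Qed.
Definition coord_vec3 := (coord0_vec3, coord1_vec3, coord2_vec3).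

Lemma vec3_coord x : vec3 (coord0 x) (coord1 x) (coord2 x) = x.
Proof.
apply/rowP => j; rewrite mxE /coord0 /coord1 /coord2.
by case: j => [[|[|[|//]]] lej] /=; congr (x 0 _); apply/val_inj; rewrite /= inordK.
Qed.

Lemma coord0_differentiable x : differentiable coord0 x.
Proof. exact: differentiable_coord. Qed.
Lemma coord0_sqr_differentiable x : differentiable (fun y => coord0 y ^+ 2) x.
Proof.
rewrite (_ : (fun y => _) = coord0 * coord0).
  by apply: differentiableM; exact: coord0_differentiable.
by apply/funext => y; rewrite !fctE expr2.
Qed.
Lemma coord1_differentiable x : differentiable coord1 x.
Proof. exact: differentiable_coord. Qed.
Lemma coord2_differentiable x : differentiable coord2 x.
Proof. exact: differentiable_coord. Qed.

Lemma vec3_differentiable (a b c : C3 -> C) x :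
  differentiable a x -> differentiable b x -> differentiable c x ->
  differentiable (fun y => vec3 (a y) (b y) (c y)) x.
Proof.
move=> da db dc.
rewrite (_ : (fun y => _) = (fun y => a y *: vec3 1 0 0) +
   (fun y => b y *: vec3 0 1 0) + (fun y => c y *: vec3 0 0 1)).
  by apply: differentiableD; [apply: differentiableD|]; exact: differentiableZl.
apply/funext => y; rewrite !fctE; apply/rowP => j; rewrite !mxE.
case: j => [[|[|[|//]]] lej] /=;
  by rewrite ?(mulr0, mulr1, addr0, add0r).
Qed.

Variable g : C -> C.
Hypothesis g_entire : forall w, differentiable g w.

Definition deformed_map (x : C3) : C3 :=
  let z := coord0 x in let u1 := coord1 x in let u2 := coord2 x in
  vec3 z^-1 (z ^+ 2 * u1 + z * g u2) u2.

Definition deformed_inv (x : C3) : C3 :=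
  let xi := coord0 x in let v1 := coord1 x in let v2 := coord2 x in
  vec3 xi^-1 (xi ^+ 2 * v1 - xi * g v2) v2.

Definition coord0_neq0 : set C3 := [set x | coord0 x != 0].

Lemma coord0_neq0_open : open coord0_neq0.
Proof.
rewrite (_ : coord0_neq0 = coord0 @^-1` [set z | z != 0]) //.
apply: open_comp; last first.
  rewrite (_ : [set z | _] = ~` [set 0]); last first.
    by apply/seteqP; split=> z /= /eqP.
  apply: closed_openC; apply: accessible_closed_set1.
  exact/hausdorff_accessible/norm_hausdorff.
by move=> x _; exact: differentiable_continuous (coord0_differentiable x).
Qed.

Lemma deformed_map_neq0 x : coord0_neq0 x -> coord0_neq0 (deformed_map x).
Proof. by rewrite /coord0_neq0 /= coord_vec3 invr_eq0. Qed.

Lemma deformed_inv_neq0 x : coord0_neq0 x -> coord0_neq0 (deformed_inv x).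
Proof. by rewrite /coord0_neq0 /= coord_vec3 invr_eq0. Qed.

Lemma deformed_mapK x :
  coord0_neq0 x -> deformed_inv (deformed_map x) = x.
Proof.
move=> x0; rewrite /deformed_inv /deformed_map !coord_vec3 invrK.
rewrite -[RHS]vec3_coord; congr vec3.
rewrite mulrDr mulrA -exprMn mulVf // expr1n mul1r.
by rewrite mulrA expr2 -(mulrA _ _ (coord0 x)) mulVf // mulr1 addrK.
Qed.

Lemma deformed_invK x :
  coord0_neq0 x -> deformed_map (deformed_inv x) = x.
Proof.
move=> x0; rewrite /deformed_inv /deformed_map !coord_vec3 invrK.
rewrite -[RHS]vec3_coord; congr vec3.
rewrite mulrBr mulrA -exprMn mulVf // expr1n mul1r.
by rewrite mulrA expr2 -(mulrA _ _ (coord0 x)) mulVf // mulr1 subrK.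
Qed.

Lemma g_coord2_differentiable x : differentiable (fun y => g (coord2 y)) x.
Proof.
by apply: (@differentiable_comp _ _ _ _ coord2 g) => //;
  exact: coord2_differentiable.
Qed.

Lemma deformed_map_differentiable x :
  coord0_neq0 x -> differentiable deformed_map x.
Proof.
move=> x0; apply: vec3_differentiable.
- apply: differentiableV => //; exact: coord0_differentiable.
- apply: differentiableD; apply: differentiableM.
  + exact: coord0_sqr_differentiable.
  + exact: coord1_differentiable.
  + exact: coord0_differentiable.
  + exact: g_coord2_differentiable.
- exact: coord2_differentiable.
Qed.

Lemma deformed_inv_differentiable x :
  coord0_neq0 x -> differentiable deformed_inv x.
Proof.
move=> x0; apply: vec3_differentiable.
- apply: differentiableV => //; exact: coord0_differentiable.
- apply: differentiableB; apply: differentiableM.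
  + exact: coord0_sqr_differentiable.
  + exact: coord1_differentiable.
  + exact: coord0_differentiable.
  + exact: g_coord2_differentiable.
- exact: coord2_differentiable.
Qed.

Lemma deformed_graph_closed x y :
  ~ (coord0_neq0 x /\ deformed_map x = y) ->
  exists A B, [/\ open_nbhs x A, open_nbhs y B &
    forall z, A z -> coord0_neq0 z -> ~ B (deformed_map z)].
Proof.
have unit_disc : open (coord0 @^-1` [set z : C | `|z| < 1]).
  apply: open_comp.
    by move=> p _; exact: differentiable_continuous (coord0_differentiable p).
  rewrite (_ : [set z : C | _] = ball 0 1); first exact: ball_open.
  by rewrite -ball_normE; apply/seteqP; split=> z /=; rewrite sub0r normrN.
have sep p q : p != q :> C3 -> exists A B,
    [/\ open_nbhs p A, open_nbhs q B & A `&` B = set0].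
  move=> pq; have := @norm_hausdorff _ C3; rewrite open_hausdorff.
  move=> /(_ p q pq)[[A B] /= [pA qB] [oA oB /eqP AB0]].
  by exists A, B; split=> //; split=> //; [rewrite inE in pA|rewrite inE in qB].
have pre (f : C3 -> C3) p A : coord0_neq0 p ->
    (forall p, coord0_neq0 p -> differentiable f p) -> open_nbhs (f p) A ->
    open_nbhs p (coord0_neq0 `&` f @^-1` A).
  move=> p0 df [oA Ap]; split; last by split.
  by apply: open_preimage_on => //; exact: coord0_neq0_open.
move=> xy; have [x0|x0] := eqVneq (coord0 x) 0; last first.
  have [A [B [xA yB AB0]]] : exists A B,
      [/\ open_nbhs (deformed_map x) A, open_nbhs y B & A `&` B = set0].
    by apply: sep; apply/eqP => e; apply: xy.
  exists (coord0_neq0 `&` deformed_map @^-1` A), B; split => //.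
    by apply: pre => //; exact: deformed_map_differentiable.
  move=> z [_ Az] _ Bz.
  by have : (A `&` B) (deformed_map z) by []; rewrite AB0.
have [y0|y0] := eqVneq (coord0 y) 0.
  exists (coord0 @^-1` [set z : C | `|z| < 1]),
         (coord0 @^-1` [set z : C | `|z| < 1]); split.
  - by split => //=; rewrite x0 normr0.
  - by split => //=; rewrite y0 normr0.
  move=> z /= z1 z0; rewrite coord_vec3 normfV => z2.
  have : 0 < `|coord0 z| by rewrite normr_gt0.
  move=> zgt0; move: z2; rewrite invf_lt1 // => z2.
  by have := lt_trans z1 z2; rewrite ltxx.
have [A [B [xA yB AB0]]] : exists A B,
    [/\ open_nbhs x A, open_nbhs (deformed_inv y) B & A `&` B = set0].
  apply: sep; apply/eqP => e; move: (deformed_inv_neq0 y0).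
  by rewrite /coord0_neq0 /= -e x0 eqxx.
exists A, (coord0_neq0 `&` deformed_inv @^-1` B); split => //.
  by apply: pre => //; exact: deformed_inv_differentiable.
move=> z Az z0 [_ /=]; rewrite deformed_mapK // => Bz.
by have : (A `&` B) z by []; rewrite AB0.
Qed.

Definition deformed_gluing : gluingData R 3 :=
  GluingData coord0_neq0_open coord0_neq0_open
    deformed_map_neq0 deformed_inv_neq0 deformed_mapK deformed_invK
    deformed_map_differentiable deformed_inv_differentiable
    deformed_graph_closed.

Definition deformed_threefold : complexManifold R 3 :=
  gluing_manifold deformed_gluing.

End Gluing3.

Section PowerSeries.
Variable R : realType.
Local Notation C := (complexField R).

Lemma geometric_dominated_cvg (u : nat -> C) (A : C) :
  (forall s, `|u s| <= A * 2^-1 ^+ s) -> cvgn (series u).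
Proof.
move=> uA.
have A0 : 0 <= A by have := uA 0%N; rewrite expr0 mulr1; exact: le_trans.
have [a a0 Aa] : exists2 a : R, 0 <= a & A = a%:C.
  case: A A0 {uA} => a b; rewrite lecE /= => /andP[/eqP -> a0].
  by exists a.
have real_cvg (v : nat -> R) : (forall s, `|v s|%:C <= `|u s|) ->
    cvgn (series v).
  move=> vu; apply: normed_cvg.
  apply: (@series_le_cvg _ _ (geometric a 2^-1)).
  - by move=> s; exact: normr_ge0.
  - by move=> s; rewrite /geometric /= mulr_ge0 // exprn_ge0 // invr_ge0.
  - move=> s; rewrite -lecR; apply: le_trans (vu s) _.
    rewrite (le_trans (uA s)) // Aa /geometric /= rmorphM rmorphXn fmorphV.
    by rewrite rmorph_nat.
  - apply: is_cvg_geometric_series.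
    by rewrite ger0_norm ?invr_ge0 // invf_lt1 ?ltr1n.
have /cvg_ex[/= x xP] : cvgn (series (fun s => complex.Re (u s))).
  by apply: real_cvg => s; exact: normc_ge_Re.
have /cvg_ex[/= y yP] : cvgn (series (fun s => complex.Im (u s))).
  apply: real_cvg => s; apply: le_trans (_ : _ <= `|(u s) * 'i%C|) _.
    by rewrite -normrN -ReiNIm; exact: normc_ge_Re.
  by rewrite normrM (_ : `|'i%C| = 1) ?mulr1 // normc_def /= expr0n expr1n
     /= add0r sqrtr1.
have seriesE n : series u n = series (fun s => complex.Re (u s)) n +i*
    series (fun s => complex.Im (u s)) n.
  rewrite /series /=; elim: n => [|n IH]; first by rewrite !big_geq.
  rewrite !big_nat_recr //= IH.
  by case: (u n).
suff : series u @ \oo --> (x +i* y : C) by move/cvgP.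
apply/pseudometric_normed_Zmodule.cvgrPdist_lt => e /complex_gt0P[r r0 ->].
have r20 : 0 < r / 2 by rewrite divr_gt0.
have [N1 _ xN] := (pseudometric_normed_Zmodule.cvgrPdist_lt _ _).1 xP _ r20.
have [N2 _ yN] := (pseudometric_normed_Zmodule.cvgrPdist_lt _ _).1 yP _ r20.
exists (maxn N1 N2) => // n; rewrite /= geq_max => /andP[/xN xn /yN yn].
rewrite seriesE [r]splitr.
exact: (@ltc_normRe R ((_ - _) +i* (_ - _)) _ xn yn).
Qed.

Definition power_sum (t : nat -> C) (w : C) : C :=
  limn (series (fun s => t s * w ^+ s)).

Lemma taylor1_bound (w h rho : C) (s : nat) :
  `|w| <= rho -> `|w + h| <= rho -> 1 <= rho ->
  `|(w + h) ^+ s - w ^+ s - s%:R * w ^+ s.-1 * h| <=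
    2 ^+ s * rho ^+ s * `|h| ^+ 2.
Proof.
move=> wr whr r1; have r0 : 0 <= rho by apply: le_trans r1.
elim: s => [|s IH].
  by rewrite !expr0 subrr mul0r mul0r subr0 normr0 !mul1r exprn_ge0.
have -> : (w + h) ^+ s.+1 - w ^+ s.+1 - s.+1%:R * w ^+ s.+1.-1 * h =
   (w + h) * ((w + h) ^+ s - w ^+ s - s%:R * w ^+ s.-1 * h) +
   s%:R * w ^+ s.-1 * h ^+ 2.
  case: s {IH} => [|s] /=; rewrite ?exprS -?natr1; ring.
apply: le_trans (ler_normD _ _) _.
have -> : 2 ^+ s.+1 * rho ^+ s.+1 * `|h| ^+ 2 =
   rho * (2 ^+ s * rho ^+ s * `|h| ^+ 2) +
   2 ^+ s * rho ^+ s.+1 * `|h| ^+ 2 by rewrite !exprS; ring.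
apply: lerD; rewrite !normrM ?normrX; first exact: ler_pM.
rewrite normr_nat; apply: ler_wpM2r; first by rewrite mulr_ge0.
apply: ler_pM; rewrite ?ler0n ?exprn_ge0 //.
  by rewrite -natrX ler_nat ltnW // ltn_expl.
apply: le_trans (lerXn2r _ _ _ wr) _ => //; rewrite ?nnegrE //.
by apply: ler_weXn2l => //; exact: leq_trans (leq_pred _) _.
Qed.

Lemma power_sum_differentiable (t : nat -> C) :
  (forall w, cvgn (series (fun s => t s * w ^+ s))) ->
  forall w, differentiable (power_sum t) w.
Proof.
move=> tcvg w.
pose rho : C := `|w| + 1.
have r1 : 1 <= rho by rewrite lerDr.
have r0 : 0 < rho by apply: lt_le_trans r1.
have [M Mt] : exists M, forall s, `|t s| * (4 * rho) ^+ s <= M.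
  have /cvg_series_cvg_0 /cvgP /cvg_seq_bounded [M [Mr]] := tcvg (4 * rho).
  move=> /(_ (M + 1)); rewrite ltrDl ltr01 => /(_ isT) HM.
  exists (M + 1) => s; have /= := HM s I.
  by rewrite normrM normrX (ger0_norm (_ : 0 <= 4 * rho)) // mulr_ge0 // ltW.
have M0 : 0 <= M by have := Mt 0%N; rewrite expr0 mulr1; exact: le_trans.
have tM s : `|t s| * (2 ^+ s * rho ^+ s) <= M * 2^-1 ^+ s.
  have -> : `|t s| * (2 ^+ s * rho ^+ s) =
      `|t s| * (4 * rho) ^+ s * 2^-1 ^+ s.
    rewrite -mulrA -!exprMn; congr (_ * _ ^+ _).
    by field.
  by apply: ler_wpM2r => //; rewrite exprn_ge0 // invr_ge0.
pose d s := t s * (s%:R * w ^+ s.-1).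
have /cvg_ex[/= D dD] : cvgn (series d).
  apply: (@geometric_dominated_cvg _ M) => s; apply: le_trans (tM s).
  rewrite /d normrM; apply: ler_wpM2l => //; rewrite normrM normr_nat normrX.
  apply: ler_pM; rewrite ?ler0n ?exprn_ge0 //.
    by rewrite -natrX ler_nat ltnW // ltn_expl.
  apply: le_trans (_ : rho ^+ s.-1 <= _).
    by apply: lerXn2r; rewrite ?nnegrE // ?lerDl // ltW.
  by apply: ler_weXn2l => //; exact: leq_pred.
have bound h : `|h| <= 1 ->
    `|power_sum t (w + h) - power_sum t w - D * h| <= M * 2 * `|h| ^+ 2.
  move=> h1.
  have lim_e : (fun n => series (fun s => t s * (w + h) ^+ s) n -
      series (fun s => t s * w ^+ s) n - series d n * h) @ \oo -->
      power_sum t (w + h) - power_sum t w - D * h.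
    apply: cvgB; last by apply: cvgMl.
    by apply: cvgB; exact: tcvg.
  apply/ler_addgt0Pr => e e0.
  have [n _ /(_ n (leqnn n)) hn] :=
    (pseudometric_normed_Zmodule.cvgrPdist_lt _ _).1 lim_e _ e0.
  rewrite -[X in `|X|](subrK (series (fun s => t s * (w + h) ^+ s) n -
    series (fun s => t s * w ^+ s) n - series d n * h)) addrC.
  apply: le_trans (ler_normD _ _) _; apply: lerD; last exact: ltW.
  rewrite /series /= mulr_suml -!sumrB.
  apply: le_trans (ler_norm_sum _ _ _) _.
  apply: le_trans (_ : \sum_(0 <= s < n) M * 2^-1 ^+ s * `|h| ^+ 2 <= _).
    apply: ler_sum => s _; rewrite /d -mulrBr -[X in _ - X]mulrA -mulrBr.
    rewrite normrM; apply: le_trans (_ : `|t s| *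
      (2 ^+ s * rho ^+ s * `|h| ^+ 2) <= _).
      apply: ler_wpM2l => //; apply: taylor1_bound => //.
        by rewrite lerDl.
      by apply: le_trans (ler_normD _ _) _; rewrite lerD2l.
    by rewrite mulrA; apply: ler_wpM2r; rewrite ?exprn_ge0.
  rewrite -mulr_suml; apply: ler_wpM2r; first by rewrite exprn_ge0.
  rewrite -mulr_sumr; apply: ler_wpM2l => //.
  have -> : \sum_(0 <= s < n) 2^-1 ^+ s = 2 - 2 * 2^-1 ^+ n :> C.
    elim: n {hn} => [|n IHn]; first by rewrite big_geq // expr0 mulr1 subrr.
    by rewrite big_nat_recr //= IHn exprS; field.
  by rewrite lerBlDr lerDl mulr_ge0 // exprn_ge0 // invr_ge0.
apply/derivable1_diffP.
suff : (fun h : C => h^-1 *: ((power_sum t \o shift w) (h *: 1) -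
    power_sum t w)) @ 0^' --> (D : C) by move/cvgP.
apply/pseudometric_normed_Zmodule.cvgrPdist_lt => e e0.
have M1 : 0 < M * 2 + 1 by rewrite ltr_wpDl // mulr_ge0.
have h1 : \forall h \near (0 : C)^', `|h| < 1 by exact: dnbhs0_lt.
have he : \forall h \near (0 : C)^', `|h| < e / (M * 2 + 1).
  by apply: dnbhs0_lt; rewrite divr_gt0.
have h0 : \forall h \near (0 : C)^', h != 0 by exact: nbhs_dnbhs_neq.
near=> h.
have hN0 : h != 0 by near: h.
have hgt0 : 0 < `|h| by rewrite normr_gt0.
have -> : D - h^-1 *: ((power_sum t \o shift w) (h *: 1) - power_sum t w) =
    - (h^-1 * (power_sum t (w + h) - power_sum t w - D * h)).
  rewrite /= [h *: 1]mulr1 [h + w]addrC [_ *: _]/(_ * _).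
  by rewrite mulrBr [D * h]mulrC mulKf // opprB.
rewrite normrN normrM normfV ltr_pdivrMl //.
have hle1 : `|h| <= 1 by apply: ltW; near: h.
apply: le_lt_trans (bound _ hle1) _.
rewrite expr2 mulrA mulrC ltr_pM2l //.
apply: le_lt_trans (_ : (M * 2 + 1) * `|h| < e).
  by apply: ler_wpM2r => //; rewrite lerDl.
have hlt : `|h| < e / (M * 2 + 1) by near: h.
by move: hlt; rewrite ltr_pdivlMr // [`|h| * _]mulrC.
Unshelve. all: by end_near.
Qed.
End PowerSeries.

Section DeformationsOfW2.
Variable R : realType.
Local Notation C := (complexField R).

Lemma exprn_entire (y : nat) (w : C) : differentiable (fun u : C => u ^+ y) w.
Proof.
elim: y => [|y IHy].
  rewrite (_ : (fun u => _) = cst 1); first exact: differentiable_cst.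
  by apply/funext => u; rewrite expr0.
rewrite (_ : (fun u => _) = (@id C) * (fun u => u ^+ y)).
  by apply: differentiableM => //; exact: ex_diff.
by apply/funext => u; rewrite !fctE exprS.
Qed.

Definition calW2 (y : nat) : complexManifold R 3 :=
  deformed_threefold (@exprn_entire y).

(* The gluing is defined on the whole of {z <> 0} exactly when the series
   \sum_s t_s u_2^s converges for every u_2; finitely supported (t_s) are a
   special case, and t = 0 gives W_2 itself. *)
Record deformation_parameter := DeformationParameter {
  coef :> nat -> C ;
  coef_entire : forall w : C, cvgn (series (fun s => coef s * w ^+ s))
}.

Definition W2_deformation (t : deformation_parameter) : complexManifold R 3 :=
  deformed_threefold (power_sum_differentiable (@coef_entire t)).

Definition isomorphism_class (t : deformation_parameter) :
    set deformation_parameter :=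
  [set s | isomorphic (W2_deformation t) (W2_deformation s)].

Section UnitParameter.
Variable y : nat.

Let delta (s : nat) : C := (s == y)%:R.

Lemma delta_cvg (w : C) :
  series (fun s => delta s * w ^+ s) @ \oo --> w ^+ y.
Proof.
apply: cvg_near_cst; exists y.+1 => // n /= yn.
rewrite /series /= (bigD1_seq y) ?iota_uniq ?mem_index_iota //=.
by rewrite /delta eqxx mul1r big1 ?addr0 // => s /negbTE ->; rewrite mul0r.
Qed.

Lemma delta_entire (w : C) : cvgn (series (fun s => delta s * w ^+ s)).
Proof. by apply/cvg_ex; exists (w ^+ y); exact: delta_cvg. Qed.

Definition unit_parameter : deformation_parameter :=
  DeformationParameter delta_entire.

Lemma calW2E : calW2 y = W2_deformation unit_parameter.
Proof.
rewrite /calW2 /W2_deformation.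
move: (@exprn_entire y) (power_sum_differentiable _) => h1 h2.
have e : (fun u : C => u ^+ y) = power_sum unit_parameter.
  by apply/funext => w; apply/esym/cvg_lim => //; exact: delta_cvg.
by move: h1 h2; rewrite e => h1 h2; congr deformed_threefold; exact: Prop_irrelevance.
Qed.
End UnitParameter.

End DeformationsOfW2.

(* Main.v *)
From mathcomp Require Import all_boot all_order all_algebra complex.
From mathcomp Require Import all_classical all_reals all_analysis.
From mathcomp Require Import ring lra.
Require Import Defs.
Local Open Scope classical_set_scope.

Set Implicit Arguments.
Unset Strict Implicit.
Unset Printing Implicit Defensive.
Import Order.TTheory GRing.Theory Num.Theory numFieldNormedType.Exports.
Local Open Scope ring_scope.

(** Write w = u_2^y.  The threefold W(y) carries the global functions
    a = u_1 = xi^2 v_1 - xi w,  b = z u_1 = xi v_1 - w,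
    c = z^2 u_1 + z w = v_1  and  T = u_2 = v_2,  subject to a c = b (b + w).
    They contract the curve Z = {u_1 = u_2 = 0}, a projective line, to the
    vertex of this hypersurface and are injective elsewhere.  The
    projection (p : q) = (z : 1) = (1 : xi) to the projective line satisfies
    q b = p a and q c = p (b + w).

    The integer y is recovered as the order to which Z can be moved in the
    direction of u_2.  The sections t |-> (z, 0, t) of U and
    t |-> (xi, 0, t) of V agree modulo t^y, so that a holomorphic function on
    W(y) restricted to them takes, modulo t^y, values depending on t only
    ([jets_agree]).

    Let f : W(y1) -> W(y2) be an isomorphism with y1 > y2, and pull a, b,
    b + w, c and T back to W(y1).  These pull-backs are constant on Z by Liouville's
    theorem, hence cannot separate the points of f(Z), so f(Z) lies over the
    vertex, that is in the curve of W(y2) ([cone_vertex]).  Move the two points z = 0 and xi = 0 of Z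
    along their sections.  At t = 0 their images have distinct projections, while
    a, b, b + w and c agree at them modulo t^y1; a linear relation between
    a and b (or b + w and c) with two different ratios forces all four to be
    O(t^y1) ([order_estimate]).  Hence T^y2 = (b + w) - b is O(t^y1), and
    since y1 > y2 this makes T = o(t).  So df sends the direction of u_2, and
    of course the direction of Z, into the tangent line of the curve in W(y2):
    it is not injective ([local_inverse_tangents]), a contradiction.

    The only function theory needed is one estimate for two functions on the
    two discs of the projective line ([circle_gluing_estimate]): if f(z) and
    g(1/z) are e-close on the unit circle, then f(0) and g(0) are 2e-close,
    since both are means over that circle.  Taking g constant gives Cauchy's
    estimate for derivatives, whence Liouville's theorem and local Lipschitz
    bounds.  The estimate itself follows from Goursat's theorem on rectangles
    ([circulation_eq0]) in the coordinate log z.  The factor 2 comes from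
    treating real and imaginary parts separately. *)

(** * Integrals of closed 1-forms over rectangles *)

Section Goursat.
Variable R : realType.

Lemma increment_bound (F f : R -> R) (a b M : R) :
  a <= b -> (forall x, a <= x <= b -> is_derive x 1 F (f x)) ->
  (forall x, a <= x <= b -> `|f x| <= M) -> `|F b - F a| <= M * (b - a).
Proof.
move=> ab dF fM.
have [x xab ->] : exists2 x, x \in `[a, b] & F b - F a = f x * (b - a).
  apply: MVT_segment => // [x xab|].
    by apply: dF; rewrite !ltW ?(itvP xab).
  apply: derivable_within_continuous => x; rewrite in_itv /= => /dF [].
  by [].
rewrite normrM [X in _ * X]ger0_norm ?subr_ge0 //.
apply: ler_wpM2r; first by rewrite subr_ge0.
by apply: fM; rewrite !(itvP xab).
Qed.

Lemma primitive_exists (f : R -> R) (N : R) : continuous f ->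
  exists F : R -> R, forall x : R, `|x| < N -> is_derive x 1 F (f x).
Proof.
move=> cf.
exists (fun y => (\int[lebesgue_measure]_(t in [set` `[- N, y]]) (f t))%R).
move=> x; rewrite ltr_norml => /andP[Nx xN].
have fi : lebesgue_measure.-integrable `[- N, N] (EFin \o f).
  apply: continuous_compact_integrable; first exact: segment_compact.
  exact: continuous_subspaceT.
have [|dF <-] := continuous_FTC1 xN fi _ (cf x).
  by rewrite /= lte_fin.
by rewrite derive1E; exact/derivableP.
Qed.

(** The affine part of the integrand is integrated exactly, so only the
    deviation from it contributes to the error. *)
Lemma increment_bound_affine (F f : R -> R) (a b x0 k0 k1 M : R) :
  a <= b -> (forall x, a <= x <= b -> is_derive x 1 F (f x)) ->
  (forall x, a <= x <= b -> `|f x - (k0 + k1 * (x - x0))| <= M) ->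
  `|F b - F a - (k0 * (b - a) + k1 * ((b - x0) ^+ 2 - (a - x0) ^+ 2) / 2)|
    <= M * (b - a).
Proof.
move=> ab dF fM.
pose G x : R := F x - (k0 * x + k1 / 2 * (x - x0) ^+ 2).
have -> : F b - F a - (k0 * (b - a) + k1 * ((b - x0) ^+ 2 - (a - x0) ^+ 2) / 2) =
    G b - G a by rewrite /G; field.
apply: (@increment_bound G (fun x => f x - (k0 + k1 * (x - x0)))) => // x xab.
have dFx := dF x xab.
apply: is_derive_eq.
by rewrite /GRing.scale /=; field.
Qed.

(** The form P dx + Q dy is totally differentiable at each point, and closed:
    the shared coefficient [q] says that dP/dy = dQ/dx. *)
Definition closed_form (P Q : R -> R -> R) : Prop :=
  forall x0 y0 : R, exists p q r : R,
  forall e, 0 < e -> exists2 d, 0 < d &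
  forall x y, `|x - x0| < d -> `|y - y0| < d ->
    `|P x y - (P x0 y0 + p * (x - x0) + q * (y - y0))| <=
      e * (`|x - x0| + `|y - y0|) /\
    `|Q x y - (Q x0 y0 + q * (x - x0) + r * (y - y0))| <=
      e * (`|x - x0| + `|y - y0|).

Variables (P Q H V : R -> R -> R) (N : R).
Hypothesis dH : forall x y : R, `|x| < N -> is_derive x 1 (H y) (P x y).
Hypothesis dV : forall x y : R, `|y| < N -> is_derive y 1 (V x) (Q x y).
Hypothesis closedPQ : closed_form P Q.

(** The integral of P dx + Q dy along the boundary of the rectangle
    [a, b] x [c, d], expressed by primitives H y of P(., y) and V x of
    Q(x, .). *)
Definition circulation (a b c d : R) : R :=
  (H c b - H c a) + (V b d - V b c) - (H d b - H d a) - (V a d - V a c).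

(** A closed form with affine coefficients has circulation 0, so only the
    deviation of P and Q from such a form counts. *)
Lemma circulation_bound a b c d x0 y0 p q r p0 q0 M :
  - N < a -> a <= b -> b < N -> - N < c -> c <= d -> d < N ->
  (forall x y, a <= x <= b -> c <= y <= d ->
    `|P x y - (p0 + p * (x - x0) + q * (y - y0))| <= M /\
    `|Q x y - (q0 + q * (x - x0) + r * (y - y0))| <= M) ->
  `|circulation a b c d| <= 2 * M * ((b - a) + (d - c)).
Proof.
move=> Na ab bN Nc cd dN PQM.
have hor y : c <= y <= d -> `|H y b - H y a -
    ((p0 + q * (y - y0)) * (b - a) + p * ((b - x0) ^+ 2 - (a - x0) ^+ 2) / 2)|
    <= M * (b - a).
  move=> ycd; apply: (@increment_bound_affine _ (P^~ y)) => // x /[dup] xab /andP[ax xb].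
    by apply: dH; rewrite ltr_norml (lt_le_trans Na ax) (le_lt_trans xb bN).
  by rewrite addrAC; case: (PQM x y xab ycd).
have ver x : a <= x <= b -> `|V x d - V x c -
    ((q0 + q * (x - x0)) * (d - c) + r * ((d - y0) ^+ 2 - (c - y0) ^+ 2) / 2)|
    <= M * (d - c).
  move=> xab; apply: (@increment_bound_affine _ (Q x)) => // y /[dup] ycd /andP[cy yd].
    by apply: dV; rewrite ltr_norml (lt_le_trans Nc cy) (le_lt_trans yd dN).
  by case: (PQM x y xab ycd).
have := hor c; have := hor d; have := ver a; have := ver b.
rewrite !lexx ab cd !ler_norml => /(_ isT)/andP[? ?] /(_ isT)/andP[? ?].
move=> /(_ isT)/andP[? ?] /(_ isT)/andP[? ?].
rewrite /circulation.
by apply/andP; split; lra.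
Qed.

Lemma circulation_split (a b c d m n : R) : circulation a b c d =
  circulation a m c n + circulation m b c n +
  circulation a m n d + circulation m b n d.
Proof. rewrite /circulation; ring. Qed.

Definition rectangle : Type := ((R * R) * (R * R))%type.
Definition circ (s : rectangle) := circulation s.1.1 s.1.2 s.2.1 s.2.2.

Lemma quarter_exists (s : rectangle) : exists t : rectangle,
  [/\ s.1.1 <= s.1.2 -> s.1.1 <= t.1.1 /\ t.1.2 <= s.1.2,
      s.2.1 <= s.2.2 -> s.2.1 <= t.2.1 /\ t.2.2 <= s.2.2,
      t.1.2 - t.1.1 = (s.1.2 - s.1.1) / 2, t.2.2 - t.2.1 = (s.2.2 - s.2.1) / 2 &
      `|circ s| <= 4 * `|circ t|].
Proof.
case: s => [[a b] [c d]] /=.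
pose m := (a + b) / 2; pose n := (c + d) / 2.
have := circulation_split a b c d m n; rewrite /circ /=.
set I := circulation a b c d; set I1 := circulation a m c n.
set I2 := circulation m b c n; set I3 := circulation a m n d.
set I4 := circulation m b n d => IE.
have [h1|h1] := leP `|I| (4 * `|I1|).
  by exists ((a, m), (c, n)); rewrite /= /m /n; split=> //; try split; lra.
have [h2|h2] := leP `|I| (4 * `|I2|).
  by exists ((m, b), (c, n)); rewrite /= /m /n; split=> //; try split; lra.
have [h3|h3] := leP `|I| (4 * `|I3|).
  by exists ((a, m), (n, d)); rewrite /= /m /n; split=> //; try split; lra.
exists ((m, b), (n, d)); rewrite /= /m /n; split=> //; try split; try lra.
rewrite -/m -/n -/I4.
have : `|I| <= `|I1| + `|I2| + `|I3| + `|I4|.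
  rewrite IE; apply: le_trans (ler_normD _ _) _; rewrite lerD2r.
  apply: le_trans (ler_normD _ _) _; rewrite lerD2r.
  exact: ler_normD.
lra.
Qed.

(** Goursat's argument: repeated quartering keeps a rectangle with at least a
    quarter of the circulation; near the limit point the form is affine up to
    e times the diameter, so the circulation is at most a multiple of e, for
    every e. *)
Lemma circulation_eq0 (a b c d : R) :
  - N < a -> a <= b -> b < N -> - N < c -> c <= d -> d < N ->
  circulation a b c d = 0.
Proof.
move=> Na ab bN Nc cd dN.
have [next nextP] := choice quarter_exists.
pose s n : rectangle := iter n next ((a, b), (c, d)).
have sS n : s n.+1 = next (s n) by [].
have width n : (s n).1.2 - (s n).1.1 = (b - a) / 2 ^+ n.
  elim: n => [|n IH]; first by rewrite expr0 divr1.
  have [_ _ -> _ _] := nextP (s n); rewrite IH exprS; field.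
  by rewrite expf_neq0.
have height n : (s n).2.2 - (s n).2.1 = (d - c) / 2 ^+ n.
  elim: n => [|n IH]; first by rewrite expr0 divr1.
  have [_ _ _ -> _] := nextP (s n); rewrite IH exprS; field.
  by rewrite expf_neq0.
have circs n : `|circulation a b c d| <= 4 ^+ n * `|circ (s n)|.
  elim: n => [|n IH]; first by rewrite expr0 mul1r.
  apply: le_trans IH _; have [_ _ _ _ h] := nextP (s n).
  by rewrite exprSr -mulrA ler_wpM2l // exprn_ge0.
have p2 n : 0 < 2 ^+ n :> R by rewrite exprn_gt0.
have le1 n : (s n).1.1 <= (s n).1.2.
  by rewrite -subr_ge0 width divr_ge0 ?subr_ge0 // ltW.
have le2 n : (s n).2.1 <= (s n).2.2.
  by rewrite -subr_ge0 height divr_ge0 ?subr_ge0 // ltW.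
have nest1 n k : (s n).1.1 <= (s (k + n)%N).1.1 /\ (s (k + n)%N).1.2 <= (s n).1.2.
  elim: k => [|k [IH1 IH2]] //; have [/(_ (le1 _)) [h1 h2] _ _ _ _] := nextP (s (k + n)%N).
  by split; [exact: le_trans IH1 h1|exact: le_trans h2 IH2].
have nest2 n k : (s n).2.1 <= (s (k + n)%N).2.1 /\ (s (k + n)%N).2.2 <= (s n).2.2.
  elim: k => [|k [IH1 IH2]] //; have [_ /(_ (le2 _)) [h1 h2] _ _ _] := nextP (s (k + n)%N).
  by split; [exact: le_trans IH1 h1|exact: le_trans h2 IH2].
have limit (u v : nat -> R) : (forall n, u n <= v n) ->
    (forall n k, u n <= u (k + n)%N /\ v (k + n)%N <= v n) ->
    exists x, forall n, u n <= x <= v n.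
  move=> uv nest.
  have cross n k : u n <= v k.
    case: (nest n k) => h _; case: (nest k n) => _ h'.
    by rewrite (le_trans h) // (le_trans (uv _)) // addnC.
  exists (sup (range u)) => n; apply/andP; split.
    by apply: ub_le_sup; [exists (v 0) => _ [k _ <-]|exists n].
  by apply: ge_sup; [exists (u 0), 0%N|move=> _ [k _ <-]].
(* The rectangles shrink to the point (x0, y0). *)
have [x0 x0P] := limit _ _ le1 nest1.
have [y0 y0P] := limit _ _ le2 nest2.
pose L := (b - a) + (d - c).
have L0 : 0 <= L by rewrite addr_ge0 // subr_ge0.
have [p [q [r loc]]] := closedPQ x0 y0.
have small e : 0 < e -> `|circulation a b c d| <= 2 * e * L ^+ 2.
  move=> e0; have [dl dl0 hdl] := loc e e0.
  (* n subdivisions bring the rectangle into the dl-neighbourhood. *)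
  have [n nP] : exists n : nat, L / 2 ^+ n < dl.
    have [k hk] : exists k : nat, L / dl < k%:R.
      by exists (Num.truncn (L / dl)).+1; exact: truncnS_gt.
    exists k; rewrite ltr_pdivrMr // mulrC -ltr_pdivrMr //.
    by rewrite (lt_le_trans hk) // -natrX ler_nat ltnW // ltn_expl.
  have wh : (b - a) / 2 ^+ n + (d - c) / 2 ^+ n = L / 2 ^+ n by rewrite -mulrDl.
  have w0 : 0 <= (b - a) / 2 ^+ n by rewrite divr_ge0 ?subr_ge0 // ltW.
  have h0 : 0 <= (d - c) / 2 ^+ n by rewrite divr_ge0 ?subr_ge0 // ltW.
  have := width n; have := height n; have := x0P n; have := y0P n.
  have := circs n; have := nest1 0%N n; have := nest2 0%N n; rewrite addn0 /circ.
  case: (s n) => [[a' b'] [c' d']] /= [cc dd] [aa bb] ci /andP[? ?] /andP[? ?] hd wd.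
  apply: (le_trans ci).
  have -> : 2 * e * L ^+ 2 = 4 ^+ n * (2 * (e * (L / 2 ^+ n)) * (L / 2 ^+ n)).
    rewrite (_ : 4 = 2 * 2); last by ring.
    by rewrite exprMn; field; rewrite expf_neq0.
  rewrite ler_wpM2l ?exprn_ge0 //.
  rewrite -{2}wh -wd -hd.
  apply: (@circulation_bound _ _ _ _ x0 y0 p q r (P x0 y0) (Q x0 y0)); try lra.
  move=> x y /andP[? ?] /andP[? ?].
  have hx : `|x - x0| <= b' - a' by rewrite ler_norml; lra.
  have hy : `|y - y0| <= d' - c' by rewrite ler_norml; lra.
  have xd : `|x - x0| < dl by lra.
  have yd : `|y - y0| < dl by lra.
  have [h1 h2] := hdl x y xd yd.
  have hL : e * (`|x - x0| + `|y - y0|) <= e * (L / 2 ^+ n).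
    by rewrite ler_wpM2l //; lra.
  by split; apply: le_trans hL.
apply/eqP; rewrite -normr_le0; apply/ler_addgt0Pr => e e0; rewrite add0r.
have k0 : 0 < 2 * L ^+ 2 + 1 by rewrite ltr_wpDl // mulr_ge0 // sqr_ge0.
apply: le_trans (small (e / (2 * L ^+ 2 + 1)) _) _; first by rewrite divr_gt0.
rewrite -[2 * _]mulrC -mulrA mulrAC ler_pdivrMr //.
by rewrite ler_wpM2l ?lerDl // ltW.
Qed.
End Goursat.

(** * Means of periodic closed forms *)

Section PeriodicMeans.
Variable R : realType.

Lemma closed_form_continuous (P Q : R -> R -> R) : closed_form P Q ->
  (forall y, continuous (P^~ y)) /\ (forall x, continuous (Q x)).
Proof.
move=> PQ.
have lip (f : R -> R) (x0 k d : R) : 0 < d ->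
    (forall x, `|x - x0| < d -> `|f x - f x0| <= k * `|x - x0|) ->
    {for x0, continuous f}.
  move=> d0 fk; apply/cvgrPdist_lt => e e0; near=> x.
  have xd : `|x - x0| < d by rewrite distrC; near: x; exact: cvgr_dist_lt.
  have k1 : 0 < `|k| + 1 by rewrite ltr_wpDl.
  have xe : `|x - x0| < e / (`|k| + 1).
    rewrite distrC; near: x; apply: cvgr_dist_lt => //.
    by rewrite divr_gt0.
  rewrite distrC; apply: le_lt_trans (fk x xd) _.
  move: xe; rewrite ltr_pdivlMr // mulrC; apply: le_lt_trans.
  apply: ler_wpM2r => //; have := ler_norm k; lra.
split=> [y x|x y]; have [p [q [r /(_ 1 ltr01) [d d0 h]]]] := PQ x y.
  apply: (@lip _ _ (`|p| + 1) d) => // x' xd.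
  have [|+ _] := h x' y xd; first by rewrite subrr normr0.
  rewrite subrr mulr0 addr0 normr0 addr0 mul1r => h1.
  rewrite mulrDl mul1r -normrM.
  have -> : P x' y - P x y =
    p * (x' - x) + (P x' y - (P x y + p * (x' - x))) by ring.
  by apply: le_trans (ler_normD _ _) _; rewrite lerD2l.
apply: (@lip _ _ (`|r| + 1) d) => // y' yd.
have [|_ +] := h x y' _ yd; first by rewrite subrr normr0.
rewrite subrr mulr0 addr0 normr0 add0r mul1r => h1.
rewrite mulrDl mul1r -normrM.
have -> : Q x y' - Q x y =
  r * (y' - y) + (Q x y' - (Q x y + r * (y' - y))) by ring.
by apply: le_trans (ler_normD _ _) _; rewrite lerD2l.
Unshelve. all: by end_near.
Qed.

(** The horizontal sides of [a, b] x [0, T] cancel by periodicity, so the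
    vertical ones carry equal integrals. *)
Lemma periodic_mean (P Q : R -> R -> R) (T N : R) : closed_form P Q -> 0 < T -> T < N ->
  (forall x y, P x (y + T) = P x y) ->
  exists V : R -> R -> R, (forall x y : R, `|y| < N -> is_derive y 1 (V x) (Q x y)) /\
    exists J, forall x, `|x| < N -> V x T - V x 0 = J.
Proof.
move=> PQ T0 TN PT; have [cP cQ] := closed_form_continuous PQ.
have [V dV] := choice (fun x => primitive_exists N (cQ x)).
have [H dH] := choice (fun y => primitive_exists N (cP y)).
exists V; split=> [x y|]; first exact: dV.
exists (V 0 T - V 0 0) => x xN.
have N0 : 0 < N by lra.
have hor a b : - N < a -> a <= b -> b < N -> H 0 b - H 0 a = H T b - H T a.
  move=> Na ab bN; apply/eqP; rewrite -subr_eq0 -normr_le0.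
  have -> : H 0 b - H 0 a - (H T b - H T a) = (H 0 b - H T b) - (H 0 a - H T a).
    by ring.
  rewrite -[leRHS](mul0r (b - a)).
  apply: (@increment_bound _ (fun x => H 0 x - H T x) (fun x => P x 0 - P x T)) => //.
    move=> z /andP[az zb].
    have zN : `|z| < N by rewrite ltr_norml; lra.
    have d1 := dH 0 z zN; have d2 := dH T z zN.
    exact: is_deriveB.
  by move=> z _; rewrite -[T]add0r PT subrr normr0.
have main a b : - N < a -> a <= b -> b < N -> V b T - V b 0 = V a T - V a 0.
  move=> Na ab bN.
  have := @circulation_eq0 _ P Q H V N (fun x y h => dH y x h)
    dV PQ a b 0 T Na ab bN.
  rewrite /circulation (hor a b) // => /(_ _ _ _)/eqP.
  rewrite oppr_lt0 => /(_ N0 (ltW T0) TN)/eqP; lra.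
have [x0|x0] := leP 0 x; first by apply: main; move: xN; rewrite ltr_norml; lra.
by apply/esym; apply: main; move: xN; rewrite ltr_norml; lra.
Qed.

(** The two means are independent of x.  They are compared with each other at
    x = 0, with c1 at x = x1 and with c2 at x = x2. *)
Lemma periodic_mean_compare (P Q P' Q' : R -> R -> R) (T x1 x2 c1 c2 e e1 e2 : R) :
  0 < T -> closed_form P Q -> closed_form P' Q' ->
  (forall x y, P x (y + T) = P x y) -> (forall x y, P' x (y + T) = P' x y) ->
  (forall y, `|Q 0 y - Q' 0 y| <= e) ->
  (forall y, `|Q x1 y - c1| <= e1) -> (forall y, `|Q' x2 y - c2| <= e2) ->
  `|c1 - c2| <= e + e1 + e2.
Proof.
move=> T0 PQ PQ' PT PT' h0 h1 h2.
pose N := T + `|x1| + `|x2| + 1.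
have n1 := normr_ge0 x1; have n2 := normr_ge0 x2.
have TN : T < N by rewrite /N; lra.
have N0 : 0 < N by lra.
have x1N : `|x1| < N by rewrite /N; lra.
have x2N : `|x2| < N by rewrite /N; lra.
have oN : `|0 : R| < N by rewrite normr0.
have [V [dV [J VJ]]] := periodic_mean PQ T0 TN PT.
have [V' [dV' [J' VJ']]] := periodic_mean PQ' T0 TN PT'.
have inN y : 0 <= y <= T -> `|y| < N by rewrite ltr_norml; lra.
have b1 : `|J - c1 * T| <= e1 * T.
  rewrite -(VJ x1) //.
  have -> : V x1 T - V x1 0 - c1 * T =
    (V x1 T - c1 * T) - (V x1 0 - c1 * 0) by ring.
  rewrite -{3}[T]subr0.
  apply: (@increment_bound _ (fun y => V x1 y - c1 * y) (fun y => Q x1 y - c1));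
    [exact: ltW| |by []].
  move=> y /inN yN; have dy := dV x1 y yN; apply: is_derive_eq.
  by rewrite [_%:A]mulr1.
have b2 : `|J' - c2 * T| <= e2 * T.
  rewrite -(VJ' x2) //.
  have -> : V' x2 T - V' x2 0 - c2 * T =
    (V' x2 T - c2 * T) - (V' x2 0 - c2 * 0) by ring.
  rewrite -{3}[T]subr0.
  apply: (@increment_bound _ (fun y => V' x2 y - c2 * y) (fun y => Q' x2 y - c2));
    [exact: ltW| |by []].
  move=> y /inN yN; have dy := dV' x2 y yN; apply: is_derive_eq.
  by rewrite [_%:A]mulr1.
have b0 : `|J - J'| <= e * T.
  rewrite -(VJ 0) // -(VJ' 0) //.
  have -> : V 0 T - V 0 0 - (V' 0 T - V' 0 0) =
    (V 0 T - V' 0 T) - (V 0 0 - V' 0 0) by ring.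
  rewrite -{3}[T]subr0.
  apply: (@increment_bound _ (fun y => V 0 y - V' 0 y) (fun y => Q 0 y - Q' 0 y));
    [exact: ltW| |by []].
  by move=> y /inN yN; have d1 := dV 0 y yN; have d2 := dV' 0 y yN; exact: is_deriveB.
rewrite -(ler_pM2r T0) -{1}[T](gtr0_norm T0) -normrM.
move: b0 b1 b2; rewrite !ler_norml => /andP[? ?] /andP[? ?] /andP[? ?].
by apply/andP; split; lra.
Qed.
End PeriodicMeans.

(** * Holomorphic functions of one variable *)

Lemma derivable_eps (K : numFieldType) (f : K -> K) (z : K) :
  derivable f z 1 -> forall e, 0 < e -> exists2 d, 0 < d &
  forall h, `|h| < d -> `|f (z + h) - f z - 'D_1 f z * h| <= e * `|h|.
Proof.
move=> fD e e0.
move: fD => /pseudometric_normed_Zmodule.cvgrPdist_lt /(_ _ e0).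
rewrite /prop_near1 => /nbhs_ballP[d d0 hd]; exists d => // h hr.
have [->|h0] := eqVneq h 0.
  by rewrite addr0 subrr mulr0 subr0 normr0 mulr0.
have hb : ball (0 : K) d h by rewrite -ball_normE /= sub0r normrN.
have := hd h hb h0; rewrite -/('D_1 f z).
rewrite /= [h *: 1]mulr1 [h + z]addrC [_ *: _]/(_ * _) => /ltW lt.
have -> : f (z + h) - f z - 'D_1 f z * h =
    - ('D_1 f z - h^-1 * (f (z + h) - f z)) * h.
  by field.
by rewrite normrM normrN ler_wpM2r.
Qed.

Lemma eps_is_derive (K : numFieldType) (f : K -> K) (z D : K) :
  (forall e, 0 < e -> exists2 d, 0 < d &
    forall h, `|h| < d -> `|f (z + h) - f z - D * h| <= e * `|h|) ->
  is_derive z 1 f D.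
Proof.
move=> fD.
suff lim : (fun h : K => h^-1 *: ((f \o shift z) (h *: 1) - f z)) @ 0^' --> D.
  by split; [move/cvgP: lim|exact: cvg_lim].
apply/pseudometric_normed_Zmodule.cvgrPdist_lt => e e0.
have e2 : 0 < e / 2 by rewrite divr_gt0.
have [d d0 hd] := fD _ e2.
have h1 : \forall h \near (0 : K)^', `|h| < d by exact: dnbhs0_lt.
have h0 : \forall h \near (0 : K)^', h != 0 by exact: nbhs_dnbhs_neq.
near=> h.
have hN0 : h != 0 by near: h.
have hgt0 : 0 < `|h| by rewrite normr_gt0.
have hlt : `|h| < d by near: h.
have -> : D - h^-1 *: ((f \o shift z) (h *: 1) - f z) =
    - (h^-1 * (f (z + h) - f z - D * h)).
  rewrite /= [h *: 1]mulr1 [h + z]addrC [_ *: _]/(_ * _).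
  by rewrite mulrBr [D * h]mulrC mulKf // opprB.
rewrite normrN normrM normfV ltr_pdivrMl //.
apply: le_lt_trans (hd h hlt) _; rewrite mulrC ltr_pM2l //.
by rewrite ltr_pdivrMr // mulrDr mulr1 ltrDl.
Unshelve. all: by end_near.
Qed.

Section OneComplexVariable.
Variable R : realType.
Local Notation C := (complexField R).
Local Open Scope complex_scope.
Implicit Types (x y e d : R) (z w h : C) (f g : C -> C).
Notation Re := complex.Re.
Notation Im := complex.Im.

Lemma Re_le_norm z : `|Re z|%:C <= `|z|.
Proof. exact: normc_ge_Re. Qed.

Lemma Im_le_norm z : `|Im z|%:C <= `|z|.
Proof.
apply: le_trans (_ : `|z * 'i%C| <= _).
  by rewrite -normrN -ReiNIm; exact: normc_ge_Re.
by rewrite normrM (_ : `|'i%C| = 1) ?mulr1 // normc_def /= expr0n expr1n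
   /= add0r sqrtr1.
Qed.

Lemma norm_realC x : `|x%:C| = `|x|%:C :> C.
Proof. by rewrite normc_def /= expr0n /= addr0 sqrtr_sqr. Qed.

Lemma norm_i : `|'i%C| = 1 :> C.
Proof. by rewrite normc_def /= expr0n /= expr1n add0r sqrtr1. Qed.

Lemma norm_le_ReIm z : `|z| <= (`|Re z| + `|Im z|)%:C.
Proof.
rewrite {1}[z]complexE (le_trans (ler_normD _ _)) //.
by rewrite normrM norm_i mul1r !norm_realC rmorphD.
Qed.

Lemma differentiable_eps f z : differentiable f z -> forall e, 0 < e ->
  exists2 d, 0 < d & forall h, `|h| < d%:C ->
    `|f (z + h) - f z - 'D_1 f z * h| <= e%:C * `|h|.
Proof.
move=> /derivable1_diffP fD e e0.
have eC : 0 < e%:C :> C by rewrite ltcR.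
have [_ /complex_gt0P[d d0 ->] hd] := derivable_eps fD eC.
by exists d.
Qed.

Lemma eps_differentiable f z D : (forall e, 0 < e ->
  exists2 d, 0 < d & forall h, `|h| < d%:C ->
    `|f (z + h) - f z - D * h| <= e%:C * `|h|) -> differentiable f z.
Proof.
move=> fD; apply/derivable1_diffP.
suff [] : is_derive z 1 f D by [].
apply: eps_is_derive => _ /complex_gt0P[e e0 ->].
have [d d0 hd] := fD e e0; exists d%:C; first by rewrite ltcR.
exact: hd.
Qed.

(** These are the real and imaginary parts of f(z) dz; that they are closed is
    the Cauchy-Riemann system. *)
Lemma holomorphic_closed_form f : (forall z, differentiable f z) ->
  closed_form (fun x y => Re (f (x +i* y))) (fun x y => - Im (f (x +i* y))) /\
  closed_form (fun x y => Im (f (x +i* y))) (fun x y => Re (f (x +i* y))).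
Proof.
move=> df.
have key x0 y0 : exists a b : R, forall e, 0 < e -> exists2 d, 0 < d &
    forall x y, `|x - x0| < d -> `|y - y0| < d ->
    `|Re (f (x +i* y)) - (Re (f (x0 +i* y0)) + a * (x - x0) - b * (y - y0))|
       <= e * (`|x - x0| + `|y - y0|) /\
    `|Im (f (x +i* y)) - (Im (f (x0 +i* y0)) + b * (x - x0) + a * (y - y0))|
       <= e * (`|x - x0| + `|y - y0|).
  have := differentiable_eps (df (x0 +i* y0)).
  case: ('D_1 f _) => a b fD; exists a, b => e e0.
  have [d d0 hd] := fD e e0; exists (d / 2); first by rewrite divr_gt0.
  move=> x y xd yd; pose h : C := (x - x0) +i* (y - y0).
  have hxy : `|h| <= (`|x - x0| + `|y - y0|)%:C by exact: norm_le_ReIm.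
  have := hd h; rewrite (le_lt_trans hxy); last first.
    by rewrite ltcR [d]splitr; exact: ltrD.
  have -> : (x0 +i* y0) + h = x +i* y :> C.
    by apply/eqP; rewrite eq_complex /= !subrKC !eqxx.
  move=> /(_ isT) ineq.
  have {ineq} := le_trans ineq (ler_wpM2l (_ : 0 <= e%:C) hxy).
  rewrite lecR ltW // -rmorphM /= => /(_ isT) ineq.
  have := le_trans (Re_le_norm _) ineq; have := le_trans (Im_le_norm _) ineq.
  rewrite !lecR; move: (f _) (f _) => [u v] [u' v'] /=.
  rewrite !ler_norml => /andP[? ?] /andP[? ?].
  by split; apply/andP; split; lra.
split=> x0 y0; have [a [b ab]] := key x0 y0.
  exists a, (- b), (- a) => e e0; have [d d0 hd] := ab e e0; exists d => // x y xd yd.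
  have [h1 h2] := hd x y xd yd; split; first by rewrite mulNr.
  rewrite -normrN; apply: le_trans h2.
  by rewrite le_eqVlt; apply/orP; left; apply/eqP; congr `|_|; ring.
exists b, a, (- b) => e e0; have [d d0 hd] := ab e e0; exists d => // x y xd yd.
by have [h1 h2] := hd x y xd yd; split=> //; rewrite mulNr.
Qed.

Definition cexp (w : C) : C :=
  (expR (Re w) * cos (Im w)) +i* (expR (Re w) * sin (Im w)).

Lemma cexpD w h : cexp (w + h) = cexp w * cexp h.
Proof.
case: w h => a b [c d]; rewrite /cexp /=.
apply/eqP; rewrite eq_complex /= expRD cosD sinD.
by apply/andP; split; apply/eqP; ring.
Qed.

Lemma cexp0 : cexp 0 = 1.
Proof.
by apply/eqP; rewrite eq_complex /cexp /= expR0 cos0 sin0 mulr1 mulr0 !eqxx.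
Qed.

Lemma cexp_neq0 w : cexp w != 0.
Proof.
apply: contra_neq (oner_neq0 C) => w0.
by rewrite -[LHS]cexp0 -[X in cexp X](subrr w) cexpD w0 mul0r.
Qed.

Lemma cexpN w : cexp (- w) = (cexp w)^-1.
Proof.
apply: (mulfI (cexp_neq0 w)).
by rewrite -cexpD subrr cexp0 mulfV // cexp_neq0.
Qed.

Lemma norm_cexp w : `|cexp w| = (expR (Re w))%:C.
Proof.
rewrite normc_def /= !exprMn -mulrDr cos2Dsin2 mulr1 sqrtr_sqr.
by rewrite ger0_norm // expR_ge0.
Qed.

Lemma cexp_periodic x y : cexp (x +i* (y + pi *+ 2)) = cexp (x +i* y).
Proof. by rewrite /cexp /= cosD2pi sinD2pi. Qed.

Lemma cexp_differentiable w : differentiable cexp w.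
Proof.
apply: (@eps_differentiable _ _ (cexp w)) => e e0.
have real_eps (F : R -> R) v : is_derive (0 : R) 1 F v -> forall e', 0 < e' ->
    exists2 d, 0 < d & forall t, `|t| < d -> `|F t - F 0 - v * t| <= e' * `|t|.
  move=> [dF <-] e' e'0; have [d d0 hd] := derivable_eps dF e'0.
  by exists d => // t td; have := hd t td; rewrite add0r.
(* The remainder of cexp at 0 is bounded by 10 k (|Re h| + |Im h|), hence by
   20 k |h|; [k] is chosen so that multiplying by |cexp w| leaves e |h|. *)
pose E := expR (Re w) * 20.
have E0 : 0 < E by rewrite mulr_gt0 // expR_gt0.
pose k := Num.min 1 (e / E).
have k0 : 0 < k by rewrite lt_min ltr01 divr_gt0.
have k1 : k <= 1 by rewrite ge_min lexx.
have kE : k * E <= e by rewrite -ler_pdivlMr // ge_min lexx orbT.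
clearbody k.
have [d1 d10 h1] := real_eps expR _ (is_derive_expR 0) k k0.
have [d2 d20 h2] := real_eps cos _ (is_derive_cos 0) k k0.
have [d3 d30 h3] := real_eps sin _ (is_derive_sin 0) k k0.
pose d := Num.min k (Num.min d1 (Num.min d2 d3)).
have d0 : 0 < d by rewrite !lt_min k0 d10 d20 d30.
exists d => // h hd.
have -> : cexp (w + h) - cexp w - cexp w * h = cexp w * (cexp h - 1 - h).
  by rewrite cexpD; ring.
have hu : `|Re h| < d by rewrite -ltcR; exact: le_lt_trans (Re_le_norm _) hd.
have hv : `|Im h| < d by rewrite -ltcR; exact: le_lt_trans (Im_le_norm _) hd.
have Rh := Re_le_norm h; have Ih := Im_le_norm h.
suff : `|cexp h - 1 - h| <= (10 * k * (`|Re h| + `|Im h|))%:C.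
  move=> le5; rewrite normrM norm_cexp.
  apply: le_trans (_ : (k * E)%:C * `|h| <= _); last first.
    by apply: ler_wpM2r => //; rewrite lecR.
  have -> : (k * E)%:C * `|h| = (expR (Re w))%:C * ((10 * k)%:C * (`|h| + `|h|)).
    rewrite /E !rmorphM /= (_ : 20%:C = 10%:C + 10%:C); last by rewrite -rmorphD /=; congr (_%:C); ring.
    ring.
  apply: ler_wpM2l; first by rewrite lecR expR_ge0.
  apply: le_trans le5 _; rewrite rmorphM /= ler_wpM2l //.
    by rewrite lecR mulr_ge0 // ltW.
  by rewrite rmorphD /=; exact: lerD.
apply: le_trans (norm_le_ReIm _) _; rewrite lecR.
case: h hu hv {hd Rh Ih} => u v /=; rewrite /d !lt_min.
move=> /and4P[uk u1 u2 u3] /and4P[vk v1 v2 v3].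
have := h1 u u1; have := h2 v v2; have := h3 v v3.
rewrite expR0 cos0 sin0 oppr0 mul0r !addr0 !mul1r ?subr0.
set al := expR u - 1 - u; set be := cos v - 1; set ga := sin v - v.
move=> hga hbe hal.
have eu : expR u = 1 + u + al by rewrite /al; ring.
have kb (t : R) : k * `|t| <= `|t| by rewrite ler_piMl.
have e3 : `|expR u| <= 3.
  rewrite eu; apply: le_trans (ler_normD _ _) _.
  have := ler_normD 1 u; rewrite normr1; have := kb u; lra.
have -> : expR u * cos v - 1 - u = al + expR u * be by rewrite /al /be; ring.
rewrite [X in _ + `|X|](_ : _ = (u + al) * v + expR u * ga); last first.
  by rewrite /al /ga; ring.
have g1 : `|expR u * be| <= 3 * (k * `|v|) by rewrite normrM ler_pM.
have g2 : `|expR u * ga| <= 3 * (k * `|v|) by rewrite normrM ler_pM.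
have g3 : `|(u + al) * v| <= (2 * k) * `|v|.
  rewrite normrM ler_wpM2r //; have := ler_normD u al; have := kb u; lra.
have := ler_normD al (expR u * be); have := ler_normD ((u + al) * v) (expR u * ga).
have := normr_ge0 u; have := normr_ge0 v.
have : 0 <= k * `|u| by rewrite mulr_ge0 // ltW.
have : 0 <= k * `|v| by rewrite mulr_ge0 // ltW.
lra.
Qed.

Lemma continuous_eps f z : {for z, continuous f} -> forall e, 0 < e ->
  exists2 d, 0 < d & forall h, `|h| < d%:C -> `|f (z + h) - f z| < e%:C.
Proof.
move=> cf e e0; have eC : 0 < e%:C :> C by rewrite ltcR.
move: cf => /pseudometric_normed_Zmodule.cvgrPdist_lt /(_ _ eC) /nbhs_ballP[_ /complex_gt0P[d d0 ->] hd].
exists d => // h hh; rewrite distrC; apply: (hd (z + h)).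
by rewrite -ball_normE /= opprD addNKr normrN.
Qed.

(** In the coordinate log z the functions f(z) and g(1/z) become entire with
    period 2 pi i, and tend to f(0), resp. g(0), as Re goes to - oo, resp.
    + oo.  Their means over vertical lines are therefore f(0) and g(0), and
    the line Re = 0 is the unit circle.  Asking only for continuity at 0
    lets the estimate apply to difference quotients. *)
Lemma circle_gluing_estimate f g e :
  {for 0, continuous f} -> {for 0, continuous g} ->
  (forall z, z != 0 -> differentiable f z) ->
  (forall z, z != 0 -> differentiable g z) ->
  (forall z, `|z| = 1 -> `|f z - g z^-1| <= e%:C) ->
  `|f 0 - g 0| <= (2 * e)%:C.
Proof.
move=> cf cg df dg fg.
pose F w := f (cexp w); pose G w := g (cexp (- w)).
have dF w : differentiable F w.
  by apply: differentiable_comp; [exact: cexp_differentiable|exact/df/cexp_neq0].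
have dG w : differentiable G w.
  rewrite /G; apply: (@differentiable_comp _ _ _ _ (fun w => cexp (- w)) g).
    apply: (@differentiable_comp _ _ _ _ (fun w => - w) cexp).
      exact: differentiableN.
    exact: cexp_differentiable.
  exact/dg/cexp_neq0.
have [F1 F2] := holomorphic_closed_form dF.
have [G1 G2] := holomorphic_closed_form dG.
have perF x y : F (x +i* (y + pi *+ 2)) = F (x +i* y) by rewrite /F cexp_periodic.
have perG x y : G (x +i* (y + pi *+ 2)) = G (x +i* y).
  by rewrite /G !cexpN cexp_periodic.
have pi2 : 0 < pi *+ 2 :> R by rewrite mulrn_wgt0 // pi_gt0.
have FG0 y : `|F (0 +i* y) - G (0 +i* y)| <= e%:C.
  by rewrite /F /G cexpN; apply: fg; rewrite norm_cexp /= expR0.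
have limF k : 0 < k -> exists x, forall y, `|F (x +i* y) - f 0| <= k%:C.
  move=> k0; have [d d0 hd] := continuous_eps cf k0.
  (* On this vertical line |cexp| is the constant d / 2. *)
  exists (ln (d / 2)) => y; apply/ltW.
  have := hd (cexp (ln (d / 2) +i* y)); rewrite add0r; apply.
  rewrite norm_cexp /= lnK ?posrE ?divr_gt0 // ltcR; lra.
have limG k : 0 < k -> exists x, forall y, `|G (x +i* y) - g 0| <= k%:C.
  move=> k0; have [d d0 hd] := continuous_eps cg k0.
  exists (- ln (d / 2)) => y; apply/ltW.
  have := hd (cexp (- (- ln (d / 2) +i* y))); rewrite add0r; apply.
  rewrite norm_cexp /= opprK lnK ?posrE ?divr_gt0 // ltcR; lra.
have RE z k : `|z| <= k%:C -> `|Re z| <= k.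
  by move=> h; rewrite -lecR; exact: le_trans (Re_le_norm _) h.
have IM z k : `|z| <= k%:C -> `|Im z| <= k.
  by move=> h; rewrite -lecR; exact: le_trans (Im_le_norm _) h.
have ReB (a b : C) : Re a - Re b = Re (a - b) by case: a b => ? ? [].
have ImB (a b : C) : Im a - Im b = Im (a - b) by case: a b => ? ? [].
have key k : 0 < k -> `|Re (f 0 - g 0)| <= e + k + k /\ `|Im (f 0 - g 0)| <= e + k + k.
  move=> k0; have [x1 h1] := limF k k0; have [x2 h2] := limG k k0.
  split; rewrite -?ReB -?ImB.
    apply: (@periodic_mean_compare _ _ _ _ _ (pi *+ 2) x1 x2 _ _ _ _ _ pi2 F2 G2).
    - by move=> x y /=; rewrite perF.
    - by move=> x y /=; rewrite perG.
    - by move=> y; rewrite ReB; exact: RE.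
    - by move=> y; rewrite ReB; exact: RE.
    - by move=> y; rewrite ReB; exact: RE.
  rewrite -normrN opprD.
  apply: (@periodic_mean_compare _ _ _ _ _ (pi *+ 2) x1 x2 _ _ _ _ _ pi2 F1 G1).
  - by move=> x y /=; rewrite perF.
  - by move=> x y /=; rewrite perG.
  - by move=> y; rewrite -opprD normrN ImB; exact: IM.
  - by move=> y; rewrite -opprD normrN ImB; exact: IM.
  - by move=> y; rewrite -opprD normrN ImB; exact: IM.
apply: le_trans (norm_le_ReIm _) _; rewrite lecR.
apply/ler_addgt0Pr => k k0.
have [|h1 h2] := key (k / 4); first by rewrite divr_gt0.
lra.
Qed.
End OneComplexVariable.

(** * Cauchy estimates *)

Section CauchyEstimates.
Variable R : realType.
Local Notation C := (complexField R).
Local Open Scope complex_scope.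
Implicit Types (x y e d r M : R) (z w h v : C) (f g : C -> C).
Notation Re := complex.Re.
Notation Im := complex.Im.

Lemma normE z : `|z| = (Re `|z|)%:C.
Proof. by rewrite normc_def. Qed.

Lemma differentiable_affine z w v : differentiable (fun h : C => z + w * h) v.
Proof.
apply: differentiableD; first exact: differentiable_cst.
by apply: differentiableM; [exact: differentiable_cst|exact: ex_diff].
Qed.

Lemma eps_continuous f z : (forall e, 0 < e -> exists2 d, 0 < d &
    forall h, `|h| < d%:C -> `|f (z + h) - f z| <= e%:C) ->
  {for z, continuous f}.
Proof.
move=> fe A /nbhs_ballP[_ /complex_gt0P[e e0 ->] eA].
have e2 : 0 < e / 2 by rewrite divr_gt0.
have [d d0 hd] := fe _ e2.
have dC : 0 < d%:C :> C by rewrite ltcR.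
apply/nbhs_ballP; exists d%:C => //= w; rewrite -ball_normE /= => wz.
apply: eA; rewrite -ball_normE /= distrC -(subrKC z w); apply: le_lt_trans (hd _ _) _; first by rewrite distrC.
by rewrite ltcR; lra.
Qed.

Lemma differentiable_away0 f g z : (forall w, w != 0 -> f w = g w) ->
  z != 0 -> differentiable g z -> differentiable f z.
Proof.
move=> fg z0; have oD : open [set h : C | h != 0].
  rewrite (_ : [set h : C | _] = ~` [set 0]); last first.
    by apply/seteqP; split=> w /= /eqP.
  apply: closed_openC; apply: accessible_closed_set1.
  exact/hausdorff_accessible/norm_hausdorff.
exact: near_differentiable oD z0 fg.
Qed.

Lemma difference_quotient_differentiable f z w h :
  (forall w, differentiable f w) -> h != 0 ->
  differentiable (fun h : C => (f (z + w * h) - f z) * h^-1) h.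
Proof.
move=> df h0.
apply: differentiableM; last by apply: differentiableV => //; exact: ex_diff.
apply: differentiableB; last exact: differentiable_cst.
apply: (@differentiable_comp _ _ _ _ (fun h => z + w * h) f); last exact: df.
exact: differentiable_affine.
Qed.

(** Cauchy's estimate: [circle_gluing_estimate] for the difference quotient of
    f at z, rescaled to the unit disc, against the constant 0. *)
Lemma derivative_bound f z r M : (forall w, differentiable f w) -> 0 < r ->
  (forall h, `|h| = r%:C -> `|f (z + h) - f z| <= M%:C) ->
  r%:C * `|'D_1 f z| <= (2 * M)%:C.
Proof.
move=> df r0 fM; pose D := 'D_1 f z.
(* The difference quotient, extended by its limit. *)
pose q h := if h == 0 then D * r%:C else (f (z + r%:C * h) - f z) / h.
have q0 : q 0 = D * r%:C by rewrite /q eqxx.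
have qE h : h != 0 -> q h = (f (z + r%:C * h) - f z) * h^-1.
  by rewrite /q => /negbTE ->.
have cq : {for 0, continuous q}.
  apply: eps_continuous => e e0.
  have er0 : 0 < e / r by rewrite divr_gt0.
  have [d d0 hd] := differentiable_eps (df z) er0.
  exists (d / r) => [|h hh]; first by rewrite divr_gt0.
  rewrite add0r distrC q0; have [->|h0] := eqVneq h 0.
    by rewrite q0 subrr normr0 lecR ltW.
  rewrite qE //; have hgt0 : 0 < `|h| by rewrite normr_gt0.
  have rh : `|r%:C * h| = r%:C * `|h| by rewrite normrM norm_realC (gtr0_norm r0).
  have := hd (r%:C * h); rewrite rh.
  have -> : r%:C * `|h| < d%:C.
    by rewrite mulrC -ltr_pdivlMr ?ltcR // -fmorphV -rmorphM //=.
  move=> /(_ isT).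
  have -> : D * r%:C - (f (z + r%:C * h) - f z) / h =
     - (f (z + r%:C * h) - f z - D * (r%:C * h)) / h by field.
  rewrite normrM normrN normfV ler_pdivrMr // => /le_trans; apply.
  by rewrite mulrA -rmorphM /= divfK // gt_eqF.
have dq h : h != 0 -> differentiable q h.
  move=> h0; apply: (differentiable_away0 qE h0).
  exact: difference_quotient_differentiable.
have c0 : {for 0, continuous (cst 0 : C -> C)} by exact: cst_continuous.
have d0 h : h != 0 -> differentiable (cst 0 : C -> C) h.
  by move=> _; exact: differentiable_cst.
have q1 h : `|h| = 1 -> `|q h - (cst 0 : C -> C) h^-1| <= M%:C.
  move=> h1; have h0 : h != 0 by rewrite -normr_eq0 h1 oner_eq0.
  rewrite qE // subr0 normrM normfV h1 invr1 mulr1; apply: fM.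
  by rewrite normrM h1 mulr1 norm_realC (gtr0_norm r0).
have := circle_gluing_estimate cq c0 dq d0 q1.
by rewrite q0 subr0 normrM norm_realC (gtr0_norm r0) mulrC.
Qed.

Lemma increment_from_derivative f v M : (forall w, differentiable f w) ->
  (forall t, 0 <= t <= 1 -> `|'D_1 f (t%:C * v)| <= M%:C) ->
  `|f v - f 0| <= (2 * M)%:C * `|v|.
Proof.
move=> df fM; pose D t := 'D_1 f (t%:C * v) * v.
have eps t e : 0 < e -> exists2 d, 0 < d & forall h : R, `|h| < d ->
   `|f ((t + h)%:C * v) - f (t%:C * v) - D t * h%:C| <= (e * `|h|)%:C.
  move=> e0; have n0 : 0 <= Re `|v| by rewrite -lecR -normE; exact: normr_ge0.
  have n1 : 0 < Re `|v| + 1 by lra.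
  have e1 : 0 < e / (Re `|v| + 1) by rewrite divr_gt0.
  have [d d0 hd] := differentiable_eps (df (t%:C * v)) e1.
  exists (d / (Re `|v| + 1)); first by rewrite divr_gt0.
  move=> h; rewrite ltr_pdivlMr // => hh.
  have hv : `|h%:C * v| = (`|h| * Re `|v|)%:C.
    by rewrite normrM norm_realC [`|v|]normE -rmorphM.
  have := hd (h%:C * v); rewrite hv ltcR.
  have h0 := normr_ge0 h.
  rewrite (le_lt_trans _ hh); last by rewrite ler_wpM2l //; lra.
  move=> /(_ isT); rewrite -mulrDl -rmorphD /=.
  have -> : 'D_1 f (t%:C * v) * (h%:C * v) = D t * h%:C by rewrite /D; ring.
  move=> /le_trans -> //.
  rewrite -rmorphM lecR /= mulrAC ler_pdivrMr // -mulrA ler_wpM2l //; first exact: ltW.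
  by rewrite ler_wpM2l //; lra.
have dRe (t : R) : is_derive t 1 (fun s : R => Re (f (s%:C * v))) (Re (D t)).
  apply: eps_is_derive => e e0; have [d d0 hd] := eps t e e0; exists d => // h hh.
  rewrite -lecR; apply: le_trans (hd h hh); apply: le_trans (Re_le_norm _).
  case: (f _) (f _) (D t) => [a b] [a' b'] [p q] /=.
  by rewrite lecR mulr0 subr0.
have dIm (t : R) : is_derive t 1 (fun s : R => Im (f (s%:C * v))) (Im (D t)).
  apply: eps_is_derive => e e0; have [d d0 hd] := eps t e e0; exists d => // h hh.
  rewrite -lecR; apply: le_trans (hd h hh); apply: le_trans (Im_le_norm _).
  case: (f _) (f _) (D t) => [a b] [a' b'] [p q] /=.
  by rewrite lecR mulr0 add0r.
have DM t : 0 <= t <= 1 -> `|D t| <= (M * Re `|v|)%:C.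
  by move=> /fM h; rewrite /D normrM [`|v|]normE rmorphM ler_wpM2r // -normE.
have b1 : `|Re (f v) - Re (f 0)| <= M * Re `|v|.
  have := @increment_bound R (fun s => Re (f (s%:C * v))) (fun t => Re (D t)) 0 1
    (M * Re `|v|) ler01 (fun t _ => dRe t).
  rewrite subr0 mulr1 mul1r mul0r; apply=> t /DM h.
  by rewrite -lecR; exact: le_trans (Re_le_norm _) h.
have b2 : `|Im (f v) - Im (f 0)| <= M * Re `|v|.
  have := @increment_bound R (fun s => Im (f (s%:C * v))) (fun t => Im (D t)) 0 1
    (M * Re `|v|) ler01 (fun t _ => dIm t).
  rewrite subr0 mulr1 mul1r mul0r; apply=> t /DM h.
  by rewrite -lecR; exact: le_trans (Im_le_norm _) h.
apply: le_trans (norm_le_ReIm _) _.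
rewrite [`|v|]normE -rmorphM /= lecR.
move: b1 b2; case: (f v) (f 0) => [a b] [a' b'] /=; lra.
Qed.

Lemma entire_lipschitz f M v : (forall w, differentiable f w) ->
  (forall w, `|w| <= 2 -> `|f w| <= M%:C) -> `|v| <= 1 ->
  `|f v - f 0| <= (8 * M)%:C * `|v|.
Proof.
move=> df fM v1.
have -> : 8 * M = 2 * (2 * (M + M)) by ring.
apply: increment_from_derivative => // t /andP[t0 t1].
have tv : `|t%:C * v| <= 1.
  by rewrite normrM norm_realC (ger0_norm t0) mulr_ile1 // lecR.
rewrite -[`|_|]mul1r; apply: (@derivative_bound f _ 1) => // h h1.
apply: le_trans (ler_normB _ _) _; rewrite rmorphD; apply: lerD; apply: fM.
  by apply: le_trans (ler_normD _ _) _; rewrite h1 -[2]/(1 + 1) lerD.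
by apply: le_trans tv _; rewrite ler1n.
Qed.

Lemma liouville f M : (forall w, differentiable f w) ->
  (forall w, `|f w| <= M%:C) -> forall v, f v = f 0.
Proof.
move=> df fM v; apply/eqP; rewrite -subr_eq0 -normr_le0.
have := @increment_from_derivative f v 0 df; rewrite mulr0 mul0r; apply=> t _.
set D := 'D_1 f _; rewrite [`|D|]normE lecR.
apply/ler_addgt0Pr => e e0; rewrite add0r.
have M0 : 0 <= M by rewrite -lecR; exact: le_trans (normr_ge0 _) (fM 0).
(* Any radius above 2 (M + M) / e brings Cauchy's bound below e. *)
pose r := 2 * (M + M) / e + 1.
have r0 : 0 < r.
  rewrite ltr_wpDl //; apply: divr_ge0; last exact: ltW.
  by rewrite mulr_ge0 // addr_ge0.
have : r%:C * `|D| <= (2 * (M + M))%:C.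
  apply: derivative_bound => // h _.
  by apply: le_trans (ler_normB _ _) _; rewrite rmorphD; exact: lerD.
rewrite [`|D|]normE -rmorphM lecR /= mulrC -ler_pdivlMr // => /le_trans; apply.
rewrite ler_pdivrMr //.
have -> : e * r = 2 * (M + M) + e by rewrite /r; field; rewrite gt_eqF.
by rewrite lerDl ltW.
Qed.
End CauchyEstimates.

(** * Functions on the two charts and their jets along the curve *)

Section Jets.
Variable R : realType.
Local Notation C := (complexField R).
Local Notation C3 := 'rV[C]_3.
Local Open Scope complex_scope.
Notation Re := complex.Re.
Notation Im := complex.Im.

Lemma vec3_curve_differentiable (a b c : C -> C) (z : C) :
  differentiable a z -> differentiable b z -> differentiable c z ->
  differentiable (fun w => vec3 (a w) (b w) (c w)) z.
Proof.
move=> da db dc.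
rewrite (_ : (fun y => _) = (fun y => a y *: vec3 1 0 0) +
   (fun y => b y *: vec3 0 1 0) + (fun y => c y *: vec3 0 0 1)).
  by apply: differentiableD; [apply: differentiableD|]; exact: differentiableZl.
apply/funext => y; rewrite !fctE; apply/rowP => j; rewrite !mxE.
case: j => [[|[|[|//]]] lej] /=;
  by rewrite ?(mulr0, mulr1, addr0, add0r).
Qed.

Lemma complex_of_pair_continuous : continuous (fun p : R * R => p.1 +i* p.2 : C).
Proof.
move=> [a b] A /nbhs_ballP[_ /complex_gt0P[e e0 ->] eA].
have e2 : 0 < e / 2 by rewrite divr_gt0.
apply/nbhs_ballP; exists (e / 2) => //= -[a' b'] [/= ha hb].
apply: eA; rewrite -ball_normE /= [e]splitr.
by apply: ltc_normRe; [exact: ha|exact: hb].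
Qed.

(** The norm takes its values in R[i]; its real part is the modulus as a real
    number. *)
Lemma modulus_continuous : continuous (fun z : C => Re `|z|).
Proof.
move=> z A /nbhs_ballP[e /= e0 eA].
have eC : 0 < e%:C :> C by rewrite ltcR.
apply/nbhs_ballP; exists e%:C => //= w; rewrite /ball /= => zw.
apply: eA; rewrite -ball_normE /= -ltcR; apply: le_lt_trans zw.
by rewrite -norm_realC rmorphB /= -!normE ler_dist_dist.
Qed.

Lemma bounded_on_box (F : C3 -> C) : continuous F ->
  exists M : R, forall a b c : C, `|a| <= 2 -> `|b| <= 2 -> `|c| <= 2 ->
    `|F (vec3 a b c)| <= M%:C.
Proof.
move=> cF.
pose I : set R := `[- 2, 2]%classic.
pose K : set C := (fun p : R * R => p.1 +i* p.2 : C) @` (I `*` I).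
have cK : compact K.
  apply: continuous_compact; last by apply: compact_setX; exact: segment_compact.
  apply: continuous_subspaceT => p; exact: complex_of_pair_continuous.
have cB : compact [set v : C3 | forall i, K (v 0 i)].
  exact: (@rV_compact _ _ (fun=> K)).
have cFB : compact ((fun v => Re `|F v|) @` [set v : C3 | forall i, K (v 0 i)]).
  apply: continuous_compact => //; apply: continuous_subspaceT => v.
  by apply: (continuous_comp (cF v)); exact: modulus_continuous.
have [M [_ hM]] := compact_bounded cFB.
have inK (z : C) : `|z| <= 2 -> K z.
  move=> z2; have z2' : `|z| <= 2%:C by rewrite rmorph_nat.
  exists (Re z, Im z); last by case: z {z2 z2'}.
  split; rewrite /I /= in_itv /= -ler_norml -lecR.
    exact: le_trans (Re_le_norm _) z2'.
  exact: le_trans (Im_le_norm _) z2'.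
exists (M + 1) => a b c a2 b2 c2; rewrite normE lecR.
apply: le_trans (ler_norm _) _; apply: (hM (M + 1)); first by rewrite ltrDl.
exists (vec3 a b c) => // i; rewrite mxE.
by case: i => [[|[|[|//]]] lej] /=; exact: inK.
Qed.

Section Glued.
Variables (y : nat) (FU FV : C3 -> C).
Hypothesis dU : forall x, differentiable FU x.
Hypothesis dV : forall x, differentiable FV x.
Hypothesis UV : forall x, coord0_neq0 x ->
  FU x = FV (deformed_map (fun u => u ^+ y) x).

Lemma glued_lineE (z u t : C) : z != 0 ->
  FU (vec3 z u t) = FV (vec3 z^-1 (z ^+ 2 * u + z * t ^+ y) t).
Proof. by move=> z0; rewrite UV /deformed_map /coord0_neq0 /= !coord_vec3. Qed.

Let lineU (t : C) : forall z, differentiable (fun z => FU (vec3 z 0 t)) z.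
Proof.
move=> z; apply: (@differentiable_comp _ _ _ _ (fun z => vec3 z 0 t) FU); last exact: dU.
by apply: vec3_curve_differentiable; [exact: ex_diff|exact: differentiable_cst..].
Qed.

Let lineV (t : C) : forall z, differentiable (fun z => FV (vec3 z 0 t)) z.
Proof.
move=> z; apply: (@differentiable_comp _ _ _ _ (fun z => vec3 z 0 t) FV); last exact: dV.
by apply: vec3_curve_differentiable; [exact: ex_diff|exact: differentiable_cst..].
Qed.

(** At u_1 = u_2 = 0 the function is entire in z and bounded, since the other
    chart bounds it for |z| >= 1. *)
Lemma constant_on_curve (z : C) : (0 < y)%N ->
  FU (vec3 z 0 0) = FU (vec3 0 0 0) /\ FV (vec3 z 0 0) = FU (vec3 0 0 0).
Proof.
move=> y0.
have [M1 h1] := bounded_on_box (fun x => differentiable_continuous (dU x)).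
have [M2 h2] := bounded_on_box (fun x => differentiable_continuous (dV x)).
have n0 : `|0 : C| <= 2 by rewrite normr0.
have M10 : 0 <= M1 by rewrite -lecR; apply: le_trans (normr_ge0 _) (h1 0 0 0 n0 n0 n0).
have M20 : 0 <= M2 by rewrite -lecR; apply: le_trans (normr_ge0 _) (h2 0 0 0 n0 n0 n0).
have l1 : M1%:C <= (M1 + M2)%:C by rewrite lecR lerDl.
have l2 : M2%:C <= (M1 + M2)%:C by rewrite lecR lerDr.
have e w : w != 0 -> FU (vec3 w 0 0) = FV (vec3 w^-1 0 0).
  by move=> w0; rewrite glued_lineE // expr0n gtn_eqF // !mulr0 addr0.
have small (w : C) : `|w| <= 1 -> `|w| <= 2 by move=> /le_trans; apply; rewrite ler1n.
have inv (w : C) : ~~ (`|w| <= 1) -> w != 0 /\ `|w^-1| <= 1.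
  rewrite -real_ltNge // => w1.
  have w0 : 0 < `|w| by apply: lt_trans w1.
  by split; [rewrite -normr_gt0|rewrite normfV invf_le1 // ltW].
have bU w : `|FU (vec3 w 0 0)| <= (M1 + M2)%:C.
  have [w1|/inv[w0 w1]] := boolP (`|w| <= 1).
    by apply: le_trans l1; apply: h1 => //; exact: small.
  by rewrite e //; apply: le_trans l2; apply: h2 => //; exact: small.
have bV w : `|FV (vec3 w 0 0)| <= (M1 + M2)%:C.
  have [w1|/inv[w0 w1]] := boolP (`|w| <= 1).
    by apply: le_trans l2; apply: h2 => //; exact: small.
  have -> : FV (vec3 w 0 0) = FU (vec3 w^-1 0 0) by rewrite e ?invr_eq0 // invrK.
  by apply: le_trans l1; apply: h1 => //; exact: small.
have cU w : FU (vec3 w 0 0) = FU (vec3 0 0 0) := liouville (lineU 0) bU w.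
have cV w : FV (vec3 w 0 0) = FV (vec3 0 0 0) := liouville (lineV 0) bV w.
split; first exact: cU.
by rewrite cV -(cU 1) e ?oner_eq0 // cV.
Qed.

(** On the unit circle the point (z, 0, t) is (1/z, z t^y, t) in the other
    chart, at distance |t|^y from (1/z, 0, t); FV is Lipschitz in its second
    variable, and [circle_gluing_estimate] carries the bound from the circle to
    the centres of the two discs. *)
Lemma jets_agree : exists K : R, forall t : C, `|t| <= 1 ->
  `|FU (vec3 0 0 t) - FV (vec3 0 0 t)| <= K%:C * `|t| ^+ y.
Proof.
have [M h] := bounded_on_box (fun x => differentiable_continuous (dV x)).
exists (2 * (8 * M)) => t t1.
have t2 : `|t| <= 2 by apply: le_trans t1 _; rewrite ler1n.
have cont f (df : forall z : C, differentiable f z) : {for 0, continuous (f : C -> C)}.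
  exact: differentiable_continuous.
rewrite -normrX [`|t ^+ y|]normE -rmorphM /= -mulrA.
apply: (@circle_gluing_estimate R (fun z => FU (vec3 z 0 t)) (fun z => FV (vec3 z 0 t))).
- exact/cont/lineU.
- exact/cont/lineV.
- by move=> z _; exact: lineU.
- by move=> z _; exact: lineV.
move=> z z1; have z0 : z != 0 by rewrite -normr_eq0 z1 oner_eq0.
rewrite glued_lineE // mulr0 add0r rmorphM /= -normE.
have -> : `|t ^+ y| = `|z * t ^+ y| by rewrite normrM z1 mul1r.
apply: (@entire_lipschitz R (fun v => FV (vec3 z^-1 v t))).
- move=> v; apply: (@differentiable_comp _ _ _ _ (fun v => vec3 z^-1 v t) FV); last exact: dV.
  by apply: vec3_curve_differentiable; [exact: differentiable_cst|exact: ex_diff|exact: differentiable_cst].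
- by move=> w w2; apply: h => //; rewrite normfV z1 invr1 ler1n.
by rewrite normrM z1 mul1r normrX exprn_ile1.
Qed.
End Glued.

(** For m > 0 the hypothesis says f = O(t^(n/m)) with n/m > 1; for m = 0 it is
    contradictory. *)
Lemma derivative_eq0_of_order (f : C -> C) (K : R) (m n : nat) :
  differentiable f 0 -> f 0 = 0 -> (m < n)%N ->
  (exists2 d : R, 0 < d & forall t, `|t| < d%:C -> `|f t| ^+ m <= K%:C * `|t| ^+ n) ->
  'D_1 f 0 = 0.
Proof.
move=> df f0 mn [d d0 fK].
apply/eqP; apply/negPn/negP => D0.
set D := 'D_1 f 0 in D0.
have Dp : 0 < Re `|D| by rewrite -ltcR -normE normr_gt0.
pose e := Re `|D| / 2.
have e0 : 0 < e by rewrite divr_gt0.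
have [d' d'0 fD] := differentiable_eps df e0.
pose L := `|K| + 1.
have K0 : 0 < L by rewrite ltr_wpDl.
(* A real point so close to 0 that K s^n <= L s^(m+1) is below (e s)^m. *)
pose s := Num.min 1 (Num.min (d / 2) (Num.min (d' / 2) (e ^+ m / (2 * L)))).
have em0 : 0 < e ^+ m by rewrite exprn_gt0.
have s0 : 0 < s.
  by rewrite /s !lt_min ltr01 !divr_gt0 // mulr_gt0.
have : s <= s by [].
rewrite {2}/s !le_min => /and4P[s1 sd sd' sK].
clearbody s.
have ns : `|s%:C| = s%:C :> C by rewrite norm_realC gtr0_norm.
have lower : (e * s)%:C <= `|f s%:C|.
  have := fD s%:C; rewrite ns ltcR add0r f0 subr0 -/D.
  have sd'lt : s < d' by lra.
  move=> /(_ sd'lt) h; have := lerB_dist (D * s%:C) (f s%:C).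
  rewrite distrC => h'; have := le_trans h' h.
  rewrite normrM ns [`|D|]normE lerBlDr -!rmorphM -lerBlDl -rmorphB /= => h2.
  apply: le_trans h2; rewrite lecR.
  by have -> : Re `|D| * s - e * s = e * s by rewrite /e; field.
have sdlt : s < d by lra.
have := fK s%:C; rewrite ns ltcR => /(_ sdlt) up.
have : (e * s) ^+ m <= K * s ^+ n.
  rewrite -lecR rmorphXn [leRHS]rmorphM rmorphXn /=; apply: le_trans up.
  by apply: lerXn2r => //; rewrite nnegrE // lecR mulr_ge0 // ltW.
rewrite exprMn => h.
have sm0 : 0 < s ^+ m by rewrite exprn_gt0.
have sn : s ^+ n <= s ^+ m * s.
  by rewrite -exprSr; apply: ler_wiXn2l => //; exact: ltW.
have : e ^+ m * s ^+ m <= L * s * s ^+ m.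
  apply: (le_trans h).
  apply: le_trans (_ : L * s ^+ n <= _).
    by rewrite ler_wpM2r ?exprn_ge0 ?ltW // /L; have := ler_norm K; lra.
  by rewrite -mulrA [s * _]mulrC ler_wpM2l // ltW.
rewrite ler_pM2r // => h3.
have : L * s <= e ^+ m / 2.
  rewrite mulrC -ler_pdivlMr //; apply: le_trans sK _.
  by rewrite invfM mulrA.
lra.
Qed.
End Jets.

(** * Functions on a glued manifold and vanishing orders *)

Section DescendedFunctions.
Variables (R : realType) (n : nat) (D : gluingData R n).
Local Notation C := (complexField R).
Local Notation Cn := 'rV[C]_n.
Variable F : bool -> Cn -> C.
Hypothesis F_glued : forall x, gluedU D x -> F true x = F false (gluing_map D x).

Definition descend (p : glued_space D) : C :=
  F (projT1 (repr p)) (projT2 (repr p)).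

(** Well-definedness: the representative chosen by the quotient may lie in the
    other chart. *)
Lemma descendE b x : descend (glued_point D b x) = F b x.
Proof.
rewrite /descend; set s := repr _.
have : glued_point D (projT1 s) (projT2 s) = glued_point D b x.
  by rewrite /glued_point /in_chart -sigT_eta /s reprK.
move/glued_pointE; case: s => c z /=.
by case: c; case: b => /=; [move=> ->|case=> Uz <-; exact: F_glued|
  case=> Ux <-; apply/esym; exact: F_glued|move=> ->].
Qed.
End DescendedFunctions.

Lemma pullback_differentiable (R : realType) (n : nat) (D1 D2 : gluingData R n)
    (F : bool -> 'rV[complexField R]_n -> complexField R)
    (f : gluing_manifold D1 -> gluing_manifold D2) :
  (forall x, gluedU D2 x -> F true x = F false (gluing_map D2 x)) ->
  (forall b x, differentiable (F b) x) -> holomorphic f ->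
  forall b x, differentiable (fun x => descend F (f (glued_point D1 b x))) x.
Proof.
move=> FE dF [cf df] b x.
have [c [x' fx]] := glued_point_surj (f (glued_point D1 b x)).
have dc : @glued_dom _ _ D2 c (f (glued_point D1 b x)) by rewrite fx; exists x'.
have cfp : continuous (fun x => f (glued_point D1 b x)).
  move=> z; apply: (continuous_comp (@glued_point_continuous _ _ D1 b z)).
  exact: cf.
have oO : open ((fun x => f (glued_point D1 b x)) @^-1` @glued_dom _ _ D2 c).
  by apply: open_comp => [z _|]; [exact: cfp|exact: glued_dom_open].
apply: (near_differentiable (g := F c \o (@glued_chart _ _ D2 c \o f \o glued_point D1 b))
  oO dc).
  by move=> z /= zc; rewrite -{1}(glued_chartK zc) descendE.
apply: differentiable_comp; last exact: dF.
have := df b c (glued_point D1 b x); rewrite /= glued_chartE; apply => //.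
by exists x.
Qed.

Section OrderEstimate.
Variable R : realType.
Local Notation C := (complexField R).
Local Open Scope complex_scope.
Notation Re := complex.Re.

Lemma locally_bounded (p : C -> C) : {for 0, continuous p} ->
  exists2 L : R, 0 <= L & exists2 d : R, 0 < d &
    forall t, `|t| < d%:C -> `|p t| <= L%:C.
Proof.
move=> cp; have [d d0 hd] := continuous_eps cp ltr01.
have n0 : 0 <= Re `|p 0| by rewrite -lecR -normE; exact: normr_ge0.
exists (Re `|p 0| + 1); first lra.
exists d => // t td; have := hd t td; rewrite add0r => h.
rewrite rmorphD /= -normE -[p t](subrK (p 0)) addrC.
by apply: le_trans (ler_normD _ _) _; rewrite lerD2l ltW.
Qed.

(** With u = p1 q2 - p2 q1, bounded away from 0, the relations give
    u a1 = q1 q2 (b1 - b2) - q1 p2 (a1 - a2) and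
    u b1 = p1 q2 (b1 - b2) - p1 p2 (a1 - a2). *)
Lemma order_estimate (a1 a2 b1 b2 p1 q1 p2 q2 : C -> C) (n : nat) (K d0 : R) :
  {for 0, continuous p1} -> {for 0, continuous q1} ->
  {for 0, continuous p2} -> {for 0, continuous q2} ->
  p1 0 * q2 0 != p2 0 * q1 0 -> 0 < d0 ->
  (forall t, `|t| < d0%:C -> q1 t * b1 t = p1 t * a1 t) ->
  (forall t, `|t| < d0%:C -> q2 t * b2 t = p2 t * a2 t) ->
  (forall t, `|t| < d0%:C -> `|a1 t - a2 t| <= K%:C * `|t| ^+ n) ->
  (forall t, `|t| < d0%:C -> `|b1 t - b2 t| <= K%:C * `|t| ^+ n) ->
  exists K' : R, exists2 d : R, 0 < d & forall t, `|t| < d%:C ->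
    `|a1 t| <= K'%:C * `|t| ^+ n /\ `|b1 t| <= K'%:C * `|t| ^+ n.
Proof.
move=> cp1 cq1 cp2 cq2 u0 d00 e1 e2 ha hb.
have [L1 L10 [d1 d10 h1]] := locally_bounded cp1.
have [L2 L20 [d2 d20 h2]] := locally_bounded cq1.
have [L3 L30 [d3 d30 h3]] := locally_bounded cp2.
have [L4 L40 [d4 d40 h4]] := locally_bounded cq2.
pose L := L1 + L2 + L3 + L4.
have LC (k : R) (z : C) : `|z| <= k%:C -> k <= L -> `|z| <= L%:C.
  by move=> h kL; apply: le_trans h _; rewrite lecR.
have LE : [/\ L1 <= L, L2 <= L, L3 <= L & L4 <= L] by rewrite /L; split; lra.
case: LE => LE1 LE2 LE3 LE4.
pose u t := p1 t * q2 t - p2 t * q1 t.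
have cu : {for 0, continuous u}.
  exact: (continuousB (continuousM cp1 cq2) (continuousM cp2 cq1)).
have un0 : 0 < Re `|u 0| by rewrite -ltcR -normE normr_gt0 subr_eq0.
pose m := Re `|u 0| / 2.
have m0 : 0 < m by rewrite divr_gt0.
clearbody L.
have [d5 d50 h5] := continuous_eps cu m0.
pose d := Num.min d0 (Num.min d1 (Num.min d2 (Num.min d3 (Num.min d4 d5)))).
have dpos : 0 < d by rewrite /d !lt_min d00 d10 d20 d30 d40 d50.
exists (2 * (L * L * K) / m), d => // t td.
have tn : `|t| = (Re `|t|)%:C := normE t.
move: td; rewrite tn ltcR /d !lt_min -!ltcR -!tn.
move=> /and5P[t0 t1 t2 t3 /andP[t4 t5]].
have l1 : `|p1 t| <= L%:C by apply: (LC L1) => //; exact: h1.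
have l2 : `|q1 t| <= L%:C by apply: (LC L2) => //; exact: h2.
have l3 : `|p2 t| <= L%:C by apply: (LC L3) => //; exact: h3.
have l4 : `|q2 t| <= L%:C by apply: (LC L4) => //; exact: h4.
have mu : m%:C <= `|u t|.
  have := h5 t t5; rewrite add0r => /ltW h.
  have := lerB_dist (u 0) (u t); rewrite distrC => h'.
  have := le_trans h' h; rewrite lerBlDl -lerBlDr; apply: le_trans.
  rewrite [`|u 0|]normE -rmorphB lecR.
  by have -> : Re `|u 0| - m = m by rewrite /m; field.
have bound (x y : C) (r s : C) : `|r| <= (L * L)%:C -> `|s| <= (L * L)%:C ->
    `|x| <= K%:C * `|t| ^+ n -> `|y| <= K%:C * `|t| ^+ n ->
    `|r * x - s * y| <= (2 * (L * L * K))%:C * `|t| ^+ n.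
  move=> hr hs hx hy; apply: le_trans (ler_normB _ _) _.
  have -> : (2 * (L * L * K))%:C * `|t| ^+ n =
     (L * L)%:C * (K%:C * `|t| ^+ n) + (L * L)%:C * (K%:C * `|t| ^+ n).
    rewrite (_ : 2 * (L * L * K) = L * L * K + L * L * K); last by ring.
    by rewrite rmorphD rmorphM /=; ring.
  by apply: lerD; rewrite normrM ler_pM.
have prod (r s : C) : `|r| <= L%:C -> `|s| <= L%:C -> `|r * s| <= (L * L)%:C.
  by move=> hr hs; rewrite normrM rmorphM /= ler_pM.
have fin (x : C) : `|u t * x| <= (2 * (L * L * K))%:C * `|t| ^+ n ->
    `|x| <= (2 * (L * L * K) / m)%:C * `|t| ^+ n.
  move=> h; have mC : 0 < m%:C :> C by rewrite ltcR.
  rewrite rmorphM fmorphV /= mulrAC ler_pdivlMr // mulrC.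
  by apply: le_trans h; rewrite normrM ler_wpM2r.
have E1 := e1 t t0; have E2 := e2 t t0.
split; apply: fin.
  have -> : u t * a1 t = (q1 t * q2 t) * (b1 t - b2 t) - (q1 t * p2 t) * (a1 t - a2 t).
    rewrite /u mulrBl.
    have -> : p1 t * q2 t * a1 t = q2 t * (q1 t * b1 t) by rewrite E1; ring.
    have -> : q1 t * q2 t * (b1 t - b2 t) = q2 t * (q1 t * b1 t) - q1 t * (q2 t * b2 t) by ring.
    by rewrite E2; ring.
  by apply: bound; [exact: prod|exact: prod|exact: hb|exact: ha].
have -> : u t * b1 t = (p1 t * q2 t) * (b1 t - b2 t) - (p1 t * p2 t) * (a1 t - a2 t).
  rewrite /u mulrBl.
  have -> : p2 t * q1 t * b1 t = p2 t * (q1 t * b1 t) by ring.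
  have -> : p1 t * q2 t * (b1 t - b2 t) = p1 t * q2 t * b1 t - p1 t * (q2 t * b2 t) by ring.
  by rewrite E1 E2; ring.
by apply: bound; [exact: prod|exact: prod|exact: hb|exact: ha].
Qed.
End OrderEstimate.

(** * Tangent directions *)

Section Tangent.
Variable R : realType.
Local Notation C := (complexField R).
Local Notation C3 := 'rV[C]_3.
Local Open Scope complex_scope.

Lemma diff_entry (i : 'I_3) (M N : C3) : 'd (fun L : C3 => L 0 i : C) M N = N 0 i.
Proof.
have @f : {linear C3 -> C}.
  by exists (fun L : C3 => L 0 i); do 2![eexists]; do ?[constructor];
     rewrite ?mxE// => ? *; rewrite ?mxE//; move=> ?; rewrite !mxE.
rewrite (_ : (fun _ => _) = f) // diff_lin //; exact: coord_continuous.
Qed.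

Lemma diff_line (e : C3) : differentiable (fun s : C => s *: e) 0 /\
  'd (fun s : C => s *: e) 0 1 = e.
Proof.
have h := is_diff_scalel (0 : C) e; split; first exact: ex_diff.
by rewrite diff_val scale1r.
Qed.

(** Reduces the differential in several variables to derivatives of functions
    of one variable. *)
Lemma diff_along_line (F : C3 -> C3) (e : C3) (i : 'I_3) : differentiable F 0 ->
  differentiable (fun s : C => F (s *: e) 0 i) 0 /\
  'd F 0 e 0 i = 'D_1 (fun s : C => F (s *: e) 0 i) 0.
Proof.
move=> dF; have [] := diff_line e.
set l := fun s : C => s *: e => dl le.
have l0 : l 0 = 0 by rewrite /l scale0r.
pose c (L : C3) : C := L 0 i.
have dF0 : differentiable F (l 0) by rewrite l0.
have dFl : differentiable (F \o l) 0 by exact: differentiable_comp.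
have dc : differentiable c ((F \o l) 0) by exact: differentiable_coord.
have dall : differentiable (c \o (F \o l)) 0 by exact: differentiable_comp.
split; first exact: dall.
transitivity ('D_1 (c \o (F \o l)) 0); last by [].
have e1 : 'd (c \o (F \o l)) 0 1 = 'd c ((F \o l) 0) ('d (F \o l) 0 1).
  exact: (congr1 (fun h => h 1) (diff_comp dFl dc)).
have e2 : 'd (F \o l) 0 1 = 'd F (l 0) ('d l 0 1).
  exact: (congr1 (fun h => h 1) (diff_comp dl dF0)).
by rewrite (deriveE _ dall) e1 diff_entry e2 le l0.
Qed.

Lemma vec3_0 : vec3 0 0 0 = 0 :> C3.
Proof. by apply/rowP => j; rewrite !mxE; case: j => [[|[|[|//]]] ?]. Qed.

Lemma scale_vec3 (s a b c : C) : s *: vec3 a b c = vec3 (s * a) (s * b) (s * c).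
Proof. by apply/rowP => j; rewrite !mxE; case: j => [[|[|[|//]]] ?]. Qed.

(** The differential of F would send the first and the third basis vector to
    the same line, yet it has a left inverse. *)
Lemma local_inverse_tangents (F G : C3 -> C3) (d : R) : 0 < d ->
  differentiable F 0 -> differentiable G (F 0) ->
  (forall e s, (e = vec3 1 0 0 \/ e = vec3 0 0 1) -> `|s| < d%:C -> G (F (s *: e)) = s *: e) ->
  (forall e, (e = vec3 1 0 0 \/ e = vec3 0 0 1) ->
    @coord1 R ('d F 0 e : C3) = 0 /\ @coord2 R ('d F 0 e : C3) = 0) -> False.
Proof.
move=> d0 dF dG GF tang.
have dGF : differentiable (G \o F) 0 by exact: (differentiable_comp dF dG).
have axis e : e = vec3 1 0 0 \/ e = vec3 0 0 1 ->
    e = @coord0 R ('d F 0 e : C3) *: 'd G (F 0) (vec3 1 0 0).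
  move=> he; have [t1 t2] := tang e he.
  rewrite -linearZ /=.
  have -> : @coord0 R ('d F 0 e : C3) *: vec3 1 0 0 = 'd F 0 e.
    by rewrite scale_vec3 mulr1 mulr0 -[RHS]vec3_coord t1 t2.
  have -> : 'd G (F 0) ('d F 0 e) = 'd (G \o F) 0 e.
    exact: (esym (congr1 (fun h : C3 -> C3 => h e) (diff_comp dF dG))).
  apply/rowP => i; rewrite (diff_along_line e i dGF).2.
  have -> : 'D_1 (fun s : C => (G \o F) (s *: e) 0 i) 0 =
      'D_1 (fun s : C => (s *: e) 0 i) 0.
    apply: near_eq_derive.
    apply/nbhs_ballP; exists d%:C; first by rewrite /= ltcR.
    move=> s; rewrite -ball_normE /= sub0r normrN => sd.
    by rewrite GF.
  suff [_ ->] : is_derive (0 : C) 1 (fun s : C => (s *: e) 0 i : C) (e 0 i) by [].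
  apply: eps_is_derive => k k0; exists 1; first exact: ltr01.
  move=> h _; rewrite add0r !mxE mul0r subr0 mulrC subrr normr0.
  by rewrite mulr_ge0 // ltW.
have e0 := axis (vec3 1 0 0) (or_introl erefl).
have e2 := axis (vec3 0 0 1) (or_intror erefl).
move: e0 e2; set a := coord0 _; set b := coord0 _; set v := 'd G _ _ => e0 e2.
have entry (k : C) (w : C3) (i : 'I_3) : (k *: w) 0 i = k * w 0 i by rewrite mxE.
have a0 : 1 = a * coord0 v by rewrite -(coord0_vec3 1 0 0) {1}e0 /coord0 entry.
have b0 : 0 = b * coord0 v by rewrite -{1}(coord0_vec3 0 0 1) e2 /coord0 entry.
have b2 : 1 = b * coord2 v by rewrite -(coord2_vec3 0 0 1) {1}e2 /coord2 entry.
have v0 : coord0 v != 0.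
  by apply/eqP => v0; move/eqP: a0; rewrite v0 mulr0 oner_eq0.
move/esym/eqP: b0; rewrite mulf_eq0 (negbTE v0) orbF => /eqP b0.
by move/eqP: b2; rewrite b0 mul0r oner_eq0.
Qed.
End Tangent.

(** * The contraction of the curve *)

Section Invariants.
Variables (R : realType) (y : nat).
Local Notation C := (complexField R).
Local Notation C3 := 'rV[C]_3.
Local Notation D := (deformed_gluing (@exprn_entire R y)).
Implicit Types (b c : bool) (x : C3).

(** [coneA], [coneB], [coneE], [coneC], [coneT] are the functions a, b, b + w, c
    and T in the charts U ([true]) and V ([false]); (projP : projQ) is the point
    of the projective line under a point of the threefold. *)
Definition coneA b x : C :=
  if b then coord1 x else coord0 x ^+ 2 * coord1 x - coord0 x * coord2 x ^+ y.
Definition coneB b x : C :=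
  if b then coord0 x * coord1 x else coord0 x * coord1 x - coord2 x ^+ y.
Definition coneE b x : C :=
  if b then coord0 x * coord1 x + coord2 x ^+ y else coord0 x * coord1 x.
Definition coneC b x : C :=
  if b then coord0 x ^+ 2 * coord1 x + coord0 x * coord2 x ^+ y else coord1 x.
Definition coneT b x : C := coord2 x.

Definition projP b x : C := if b then coord0 x else 1.
Definition projQ b x : C := if b then 1 else coord0 x.

Let pow x : differentiable (fun x : C3 => coord2 x ^+ y) x.
Proof. exact: (g_coord2_differentiable (@exprn_entire R y)). Qed.
Let d0 x : differentiable (@coord0 R) x := coord0_differentiable x.
Let d1 x : differentiable (@coord1 R) x := coord1_differentiable x.
Let dsq x : differentiable (fun x : C3 => coord0 x ^+ 2) x := coord0_sqr_differentiable x.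

Lemma coneA_differentiable b x : differentiable (coneA b) x.
Proof.
case: b; first exact: d1.
by apply: differentiableB; apply: differentiableM.
Qed.
Lemma coneB_differentiable b x : differentiable (coneB b) x.
Proof.
case: b; first by apply: differentiableM.
apply: differentiableB; last exact: pow.
exact: (differentiableM (d0 x) (d1 x)).
Qed.
Lemma coneE_differentiable b x : differentiable (coneE b) x.
Proof.
case: b; last by apply: differentiableM.
apply: differentiableD; last exact: pow.
exact: (differentiableM (d0 x) (d1 x)).
Qed.
Lemma coneC_differentiable b x : differentiable (coneC b) x.
Proof.
case: b; last exact: d1.
by apply: differentiableD; apply: differentiableM.
Qed.
Lemma coneT_differentiable b x : differentiable (coneT b) x.
Proof. exact: coord2_differentiable. Qed.
Lemma projP_differentiable b x : differentiable (projP b) x.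
Proof. by case: b; [exact: d0|exact: differentiable_cst]. Qed.
Lemma projQ_differentiable b x : differentiable (projQ b) x.
Proof. by case: b; [exact: differentiable_cst|exact: d0]. Qed.

Lemma cone_glued x : gluedU D x ->
  [/\ coneA true x = coneA false (gluing_map D x),
      coneB true x = coneB false (gluing_map D x),
      coneE true x = coneE false (gluing_map D x),
      coneC true x = coneC false (gluing_map D x) &
      coneT true x = coneT false (gluing_map D x)].
Proof.
move=> /= x0; rewrite /coneA /coneB /coneE /coneC /coneT /deformed_map !coord_vec3.
by split=> //; field.
Qed.

Lemma cone_proj_relations b x :
  projQ b x * coneB b x = projP b x * coneA b x /\
  projQ b x * coneC b x = projP b x * coneE b x.
Proof.
rewrite /projQ /projP /coneA /coneB /coneE /coneC; case: b; split; ring.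
Qed.

Lemma coneT_pow b x : coneT b x ^+ y = coneE b x - coneB b x.
Proof. by rewrite /coneT /coneE /coneB; case: b; ring. Qed.

(** Over a given point of the projective line, the coordinates along the fibre
    are (a, T) in U and (c, T) in V. *)
Lemma cone_separates b c x x' :
  coneA b x = coneA c x' -> coneC b x = coneC c x' -> coneT b x = coneT c x' ->
  projP b x * projQ c x' = projP c x' * projQ b x ->
  glued_point D b x = glued_point D c x'.
Proof.
have ext z z' : coord0 z = coord0 z' -> coord1 z = coord1 z' ->
    coord2 z = coord2 z' -> z = z' :> C3.
  by move=> e0 e1 e2; rewrite -[z]vec3_coord -[z']vec3_coord e0 e1 e2.
have mixed z z' : coneC true z = coord1 z' -> coord2 z = coord2 z' ->
    coord0 z * coord0 z' = 1 -> @glued R 3 D (in_chart true z) (in_chart false z').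
  move=> eC eT zz; have z0 : coord0 z != 0.
    by apply/eqP => z0; move/eqP: zz; rewrite z0 mul0r eq_sym oner_eq0.
  split=> //; apply: ext; rewrite /= /deformed_map coord_vec3 //.
  by rewrite -[coord0 z'](mulKf z0) zz mulr1.
case: b; case: c; rewrite /coneT /projP /projQ => eA eC eT.
- by rewrite mulr1 mulr1 => e0; congr glued_point; apply: ext.
- by rewrite mulr1 => e0; apply/glued_pointE/mixed.
- by rewrite mul1r => e0; apply/esym/glued_pointE/mixed.
- by rewrite mul1r mul1r => e0; congr glued_point; apply: ext.
Qed.

(** Two proportionalities with different ratios hold for the same pairs (a, b)
    and (b + w, c), which must vanish. *)
Lemma cone_vertex b c x x' :
  coneA b x = coneA c x' -> coneB b x = coneB c x' -> coneE b x = coneE c x' ->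
  coneC b x = coneC c x' ->
  projP b x * projQ c x' != projP c x' * projQ b x ->
  [/\ coneA b x = 0, coneB b x = 0, coneE b x = 0 & coneC b x = 0].
Proof.
rewrite -subr_eq0 => eA eB eE eC u0.
have [r1 r2] := cone_proj_relations b x; have [s1 s2] := cone_proj_relations c x'.
rewrite -eA -eB -eE -eC in s1 s2.
split; apply: (mulfI u0); rewrite mulr0 mulrBl; apply/eqP; rewrite subr_eq0; apply/eqP.
- have -> : projP b x * projQ c x' * coneA b x = projQ c x' * (projQ b x * coneB b x).
    by rewrite r1; ring.
  have -> : projP c x' * projQ b x * coneA b x = projQ b x * (projQ c x' * coneB b x).
    by rewrite s1; ring.
  ring.
- have -> : projP b x * projQ c x' * coneB b x = projP b x * (projQ c x' * coneB b x) by ring.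
  have -> : projP c x' * projQ b x * coneB b x = projP c x' * (projQ b x * coneB b x) by ring.
  by rewrite r1 s1; ring.
- have -> : projP b x * projQ c x' * coneE b x = projQ c x' * (projQ b x * coneC b x).
    by rewrite r2; ring.
  have -> : projP c x' * projQ b x * coneE b x = projQ b x * (projQ c x' * coneC b x).
    by rewrite s2; ring.
  ring.
- have -> : projP b x * projQ c x' * coneC b x = projP b x * (projQ c x' * coneC b x) by ring.
  have -> : projP c x' * projQ b x * coneC b x = projP c x' * (projQ b x * coneC b x) by ring.
  by rewrite r2 s2; ring.
Qed.
End Invariants.

(** * Non-isomorphism and the classification *)

Section NotIsomorphic.
Variable R : realType.
Local Notation C := (complexField R).
Local Notation C3 := 'rV[C]_3.
Local Notation gl y := (deformed_gluing (@exprn_entire R y)).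
Local Open Scope complex_scope.

Section Pullback.
Variables (y1 y2 : nat) (f : calW2 R y1 -> calW2 R y2) (F : bool -> C3 -> C).
Hypothesis hf : holomorphic f.
Hypothesis F_glued : forall x, gluedU (gl y2) x ->
  F true x = F false (gluing_map (gl y2) x).
Hypothesis dF : forall b x, differentiable (F b) x.

Definition pulled b x : C := descend F (f (glued_point (gl y1) b x)).

Lemma pulledE b x c w : f (glued_point (gl y1) b x) = glued_point (gl y2) c w ->
  pulled b x = F c w.
Proof. by move=> e; rewrite /pulled e descendE. Qed.

Lemma pulled_chartE b x c : @glued_dom _ _ (gl y2) c (f (glued_point (gl y1) b x)) ->
  pulled b x = F c (glued_chart c (f (glued_point (gl y1) b x))).
Proof. by move=> xc; apply: pulledE; rewrite glued_chartK. Qed.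

Let dP b x : differentiable (pulled b) x.
Proof. exact: (pullback_differentiable F_glued dF hf). Qed.

Let gP x : coord0_neq0 x ->
  pulled true x = pulled false (deformed_map (fun u => u ^+ y1) x).
Proof. by move=> x0; congr (descend F (f _)); apply/glued_pointE. Qed.

Lemma pulled_constant b z : (0 < y1)%N ->
  pulled b (vec3 z 0 0) = pulled true (vec3 0 0 0).
Proof.
move=> y0; have [e1 e2] := constant_on_curve (dP true) (dP false) gP z y0.
by case: b.
Qed.

Lemma pulled_jets : exists K : R, forall t : C, `|t| <= 1 ->
  `|pulled true (vec3 0 0 t) - pulled false (vec3 0 0 t)| <= K%:C * `|t| ^+ y1.
Proof. exact: (jets_agree (dP true) (dP false) gP). Qed.
End Pullback.

(** An isomorphism from W(y1) to W(y2) with y1 > y2 would kill a tangent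
    direction transverse to the compact curve. *)
Lemma calW2_not_isomorphic (y1 y2 : nat) : (0 < y2)%N -> (y2 < y1)%N ->
  ~ isomorphic (calW2 R y1) (calW2 R y2).
Proof.
move=> y20 y21 [f [g [hf hg fg _]]].
have y10 : (0 < y1)%N by exact: ltn_trans y21.
pose D1 := gl y1; pose D2 := gl y2.
pose pt (b : bool) (x : C3) : calW2 R y2 := f (glued_point D1 b x).
have gA x (x0 : gluedU D2 x) : coneA y2 true x = coneA y2 false (gluing_map D2 x).
  by case: (cone_glued x0).
have gB x (x0 : gluedU D2 x) : coneB y2 true x = coneB y2 false (gluing_map D2 x).
  by case: (cone_glued x0).
have gE x (x0 : gluedU D2 x) : coneE y2 true x = coneE y2 false (gluing_map D2 x).
  by case: (cone_glued x0).
have gC x (x0 : gluedU D2 x) : coneC y2 true x = coneC y2 false (gluing_map D2 x).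
  by case: (cone_glued x0).
have gT x (x0 : gluedU D2 x) : coneT true x = coneT false (gluing_map D2 x).
  by case: (cone_glued x0).
pose pA := pulled f (coneA y2); pose pB := pulled f (coneB y2).
pose pE := pulled f (coneE y2); pose pC := pulled f (coneC y2).
pose pT := pulled f (@coneT R).
have cA b z : pA b (vec3 z 0 0) = pA true (vec3 0 0 0).
  exact: (pulled_constant hf gA (@coneA_differentiable R y2) b z y10).
have cB b z : pB b (vec3 z 0 0) = pB true (vec3 0 0 0).
  exact: (pulled_constant hf gB (@coneB_differentiable R y2) b z y10).
have cE b z : pE b (vec3 z 0 0) = pE true (vec3 0 0 0).
  exact: (pulled_constant hf gE (@coneE_differentiable R y2) b z y10).
have cC b z : pC b (vec3 z 0 0) = pC true (vec3 0 0 0).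
  exact: (pulled_constant hf gC (@coneC_differentiable R y2) b z y10).
have cT b z : pT b (vec3 z 0 0) = pT true (vec3 0 0 0).
  exact: (pulled_constant hf gT (@coneT_differentiable R) b z y10).
have eA := @pulledE y1 y2 f _ gA; have eB := @pulledE y1 y2 f _ gB.
have eE := @pulledE y1 y2 f _ gE; have eC := @pulledE y1 y2 f _ gC.
have eT := @pulledE y1 y2 f _ gT.
(* The pulled-back functions are constant on the curve, so distinct points of
   it have images over distinct points of the projective line. *)
have det b z b' z' c w c' w' : pt b (vec3 z 0 0) = glued_point D2 c w ->
    pt b' (vec3 z' 0 0) = glued_point D2 c' w' ->
    ~ @glued R 3 D1 (in_chart b (vec3 z 0 0)) (in_chart b' (vec3 z' 0 0)) ->
    projP c w * projQ c' w' != projP c' w' * projQ c w.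
  move=> e e' ng; apply/eqP => u; apply: ng; apply/glued_pointE.
  rewrite -[LHS]fg -[RHS]fg; congr g; rewrite -/(pt _ _) -/(pt _ _) e e'.
  apply: cone_separates u.
  - by rewrite -(eA _ _ _ _ e) -(eA _ _ _ _ e') -!/pA !cA.
  - by rewrite -(eC _ _ _ _ e) -(eC _ _ _ _ e') -!/pC !cC.
  - by rewrite -(eT _ _ _ _ e) -(eT _ _ _ _ e') -!/pT !cT.
have [c1 [w1 h1]] := glued_point_surj (pt true (vec3 0 0 0)).
have [c2 [w2 h2]] := glued_point_surj (pt false (vec3 0 0 0)).
(* The points z = 0 and xi = 0 are distinct. *)
have u0 : projP c1 w1 * projQ c2 w2 != projP c2 w2 * projQ c1 w1.
  apply: (det true 0 false 0) => // -[] /=.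
  by rewrite /coord0_neq0 /= coord0_vec3 eqxx.
have [zA zB zE zC] : [/\ coneA y2 c1 w1 = 0, coneB y2 c1 w1 = 0,
    coneE y2 c1 w1 = 0 & coneC y2 c1 w1 = 0].
  apply: (cone_vertex _ _ _ _ u0).
  - by rewrite -(eA _ _ _ _ h1) -(eA _ _ _ _ h2) -!/pA !cA.
  - by rewrite -(eB _ _ _ _ h1) -(eB _ _ _ _ h2) -!/pB !cB.
  - by rewrite -(eE _ _ _ _ h1) -(eE _ _ _ _ h2) -!/pE !cE.
  - by rewrite -(eC _ _ _ _ h1) -(eC _ _ _ _ h2) -!/pC !cC.
have zT : coneT c1 w1 = 0.
  apply/eqP; have /eqP := coneT_pow y2 c1 w1.
  by rewrite zE zB subrr expf_eq0 y20.
have vA b z : pA b (vec3 z 0 0) = 0 by rewrite cA /pA (eA _ _ _ _ h1).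
have vC b z : pC b (vec3 z 0 0) = 0 by rewrite cC /pC (eC _ _ _ _ h1).
have vT b z : pT b (vec3 z 0 0) = 0 by rewrite cT /pT (eT _ _ _ _ h1).
pose phi b c x := glued_chart (D := D2) c (pt b x).
have dphi b c x : @glued_dom _ _ D2 c (pt b x) -> differentiable (phi b c) x.
  move=> xc; have [_ /(_ b c (glued_point D1 b x))] := hf.
  by rewrite /= glued_chartE; apply => //; exists x.
have near_dom b c (e : C3) : @glued_dom _ _ D2 c (pt b 0) ->
    exists2 d : R, 0 < d & forall s : C, `|s| < d%:C -> @glued_dom _ _ D2 c (pt b (s *: e)).
  move=> oc.
  have ct : {for 0, continuous (fun s : C => pt b (s *: e))}.
    apply: (@continuous_comp _ _ _ (fun s : C => s *: e) (pt b)).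
      exact: scalel_continuous.
    apply: (@continuous_comp _ _ _ (glued_point D1 b) f).
      exact: glued_point_continuous.
    by case: hf => cf _; exact: cf.
  have : nbhs (0 : C) (fun s : C => @glued_dom _ _ D2 c (pt b (s *: e))).
    apply: ct; apply: open_nbhs_nbhs; split; first exact: glued_dom_open.
    by rewrite scale0r.
  move=> /nbhs_ballP[_ /complex_gt0P[d d0 ->] hd]; exists d => // s sd.
  by apply: hd; rewrite -ball_normE /= sub0r normrN.
have lineE (s a b c : C) : s *: vec3 a b c = vec3 (s * a) (s * b) (s * c) := scale_vec3 s a b c.
have line2 (t : C) : vec3 0 0 t = t *: vec3 0 0 1 by rewrite lineE !mulr0 mulr1.
have line0 (t : C) : vec3 t 0 0 = t *: vec3 1 0 0 by rewrite lineE !mulr0 mulr1.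
have dom1 : @glued_dom _ _ D2 c1 (pt true 0) by rewrite -vec3_0 h1; exists w1.
have dom2 : @glued_dom _ _ D2 c2 (pt false 0) by rewrite -vec3_0 h2; exists w2.
have [d1 d10 hd1] := near_dom true c1 (vec3 0 0 1) dom1.
have [d2 d20 hd2] := near_dom false c2 (vec3 0 0 1) dom2.
have [d3 d30 hd3] := near_dom true c1 (vec3 1 0 0) dom1.
pose d := Num.min 1 (Num.min d1 (Num.min d2 d3)).
have d0 : 0 < d by rewrite /d !lt_min ltr01 d10 d20 d30.
have dE (t : C) : `|t| < d%:C -> [/\ `|t| <= 1 :> C, `|t| < d1%:C, `|t| < d2%:C & `|t| < d3%:C].
  rewrite [`|t|]normE ltcR /d !lt_min -!ltcR -normE => /and4P[a1 a2 a3 a4].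
  by split=> //; exact: ltW.
clearbody d.
have phi1 : phi true c1 (vec3 0 0 0) = w1 by rewrite /phi h1 glued_chartE.
have phi2 : phi false c2 (vec3 0 0 0) = w2 by rewrite /phi h2 glued_chartE.
have cts b c (G : C3 -> C) : @glued_dom _ _ D2 c (pt b 0) ->
    (forall x, differentiable G x) ->
    {for 0, continuous (fun t : C => G (phi b c (vec3 0 0 t)))}.
  move=> bc dG; apply: differentiable_continuous.
  apply: (@differentiable_comp _ _ _ _ (fun t : C => phi b c (vec3 0 0 t)) G) => //.
  apply: (@differentiable_comp _ _ _ _ (fun t : C => vec3 0 0 t) (phi b c)).
    apply: vec3_curve_differentiable; [exact: differentiable_cst|exact: differentiable_cst|exact: ex_diff].
  by apply: dphi; rewrite vec3_0.
have order (F1 F2 : bool -> C3 -> C) :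
    (forall x, gluedU D2 x -> F1 true x = F1 false (gluing_map D2 x)) ->
    (forall x, gluedU D2 x -> F2 true x = F2 false (gluing_map D2 x)) ->
    (forall b x, differentiable (F1 b) x) -> (forall b x, differentiable (F2 b) x) ->
    (forall c x, projQ c x * F2 c x = projP c x * F1 c x) ->
    exists K : R, exists2 r : R, 0 < r & forall t, `|t| < r%:C ->
      `|pulled f F1 true (vec3 0 0 t)| <= K%:C * `|t| ^+ y1 /\
      `|pulled f F2 true (vec3 0 0 t)| <= K%:C * `|t| ^+ y1.
  move=> G1 G2 dF1 dF2 rel.
  have [K1 J1] := pulled_jets hf G1 dF1.
  have [K2 J2] := pulled_jets hf G2 dF2.
  pose K := `|K1| + `|K2|.
  have K1K : K1 <= K by rewrite /K; have := ler_norm K1; have := normr_ge0 K2; lra.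
  have K2K : K2 <= K by rewrite /K; have := ler_norm K2; have := normr_ge0 K1; lra.
  apply: (@order_estimate R (fun t => pulled f F1 true (vec3 0 0 t))
    (fun t => pulled f F1 false (vec3 0 0 t)) (fun t => pulled f F2 true (vec3 0 0 t))
    (fun t => pulled f F2 false (vec3 0 0 t))
    (fun t => projP c1 (phi true c1 (vec3 0 0 t))) (fun t => projQ c1 (phi true c1 (vec3 0 0 t)))
    (fun t => projP c2 (phi false c2 (vec3 0 0 t))) (fun t => projQ c2 (phi false c2 (vec3 0 0 t)))
    y1 K d).
  - by apply: cts => // x; exact: projP_differentiable.
  - by apply: cts => // x; exact: projQ_differentiable.
  - by apply: cts => // x; exact: projP_differentiable.
  - by apply: cts => // x; exact: projQ_differentiable.
  - by rewrite phi1 phi2.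
  - exact: d0.
  - move=> t /dE[_ t1 _ _]; have := hd1 t t1; rewrite -line2 => dm.
    by rewrite (pulled_chartE G1 dm) (pulled_chartE G2 dm); exact: rel.
  - move=> t /dE[_ _ t2 _]; have := hd2 t t2; rewrite -line2 => dm.
    by rewrite (pulled_chartE G1 dm) (pulled_chartE G2 dm); exact: rel.
  - move=> t /dE[t1 _ _ _]; apply: le_trans (J1 t t1) _.
    by rewrite ler_wpM2r ?exprn_ge0 // lecR.
  - move=> t /dE[t1 _ _ _]; apply: le_trans (J2 t t1) _.
    by rewrite ler_wpM2r ?exprn_ge0 // lecR.
have [K [r r0 oAB]] := order _ _ gA gB (@coneA_differentiable R y2)
  (@coneB_differentiable R y2) (fun c x => (cone_proj_relations y2 c x).1).
have [K' [r' r'0 oEC]] := order _ _ gE gC (@coneE_differentiable R y2)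
  (@coneC_differentiable R y2) (fun c x => (cone_proj_relations y2 c x).2).
pose m := Num.min d (Num.min r r').
have m0 : 0 < m by rewrite /m !lt_min d0 r0 r'0.
have mE (t : C) : `|t| < m%:C -> [/\ `|t| < d%:C, `|t| < r%:C & `|t| < r'%:C].
  by rewrite [`|t|]normE ltcR /m !lt_min -!ltcR -normE => /and3P[].
pose psi := glued_chart (D := D1) true \o g \o glued_point D2 c1.
have dm0 (s : C) : `|s| < m%:C -> @glued_dom _ _ D2 c1 (pt true (s *: vec3 1 0 0)).
  by move=> /mE[/dE[_ _ _ /hd3]].
have dm2 (s : C) : `|s| < m%:C -> @glued_dom _ _ D2 c1 (pt true (s *: vec3 0 0 1)).
  by move=> /mE[/dE[_ /hd1]].
apply: (@local_inverse_tangents R (phi true c1) psi m) => //.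
- exact: dphi.
- have [_ /(_ c1 true (pt true 0))] := hg; apply => //=.
  by rewrite /pt fg; exists 0.
- move=> e s he sm; rewrite /psi /= /phi glued_chartK.
    by rewrite /pt fg glued_chartE.
  by case: he => ->; [exact: dm0|exact: dm2].
(* The fibre coordinate of either chart is one of the four functions. *)
have coord1E c (x : C3) : coord1 x = if c then coneA y2 c x else coneC y2 c x by case: c.
have coord1_phi x : @glued_dom _ _ D2 c1 (pt true x) ->
    coord1 (phi true c1 x) = if c1 then pA true x else pC true x.
  move=> dx; rewrite (coord1E c1) /pA /pC.
  by rewrite (pulled_chartE gA dx) (pulled_chartE gC dx).
have coord2_phi x : @glued_dom _ _ D2 c1 (pt true x) ->
    coord2 (phi true c1 x) = pT true x.
  by move=> dx; rewrite /pT (pulled_chartE gT dx).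
have dphi0 : differentiable (phi true c1) 0 by exact: dphi.
have phi0 (e : C3) : coord1 (phi true c1 (0 *: e)) = 0 /\ coord2 (phi true c1 (0 *: e)) = 0.
  rewrite scale0r coord1_phi // coord2_phi // -vec3_0 vA vC vT.
  by split=> //; case: (c1).
have tangent (e : C3) (KK : R) (n1 n2 k1 k2 : nat) : (n1 < k1)%N -> (n2 < k2)%N ->
    (forall s, `|s| < m%:C ->
      `|coord1 (phi true c1 (s *: e))| ^+ n1 <= KK%:C * `|s| ^+ k1 /\
      `|coord2 (phi true c1 (s *: e))| ^+ n2 <= KK%:C * `|s| ^+ k2) ->
    coord1 ('d (phi true c1) 0 e : C3) = 0 /\ coord2 ('d (phi true c1) 0 e : C3) = 0.
  move=> nk1 nk2 bd; split.
    have [dl eD] := diff_along_line e (inord 1) dphi0; rewrite /coord1 eD.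
    apply: (derivative_eq0_of_order (K := KK) dl _ nk1); first exact: (phi0 e).1.
    by exists m => // s /bd[].
  have [dl eD] := diff_along_line e (inord 2) dphi0; rewrite /coord2 eD.
  apply: (derivative_eq0_of_order (K := KK) dl _ nk2); first exact: (phi0 e).2.
  by exists m => // s /bd[].
move=> e [->|->].
  (* Along the curve coord1 and coord2 vanish identically. *)
  apply: (@tangent _ 0 1%N 1%N 2%N 2%N) => // s sm.
  rewrite coord1_phi ?coord2_phi; [|exact: dm0|exact: dm0].
  rewrite -line0 vA vC vT; case: (c1); rewrite normr0 expr1 mul0r; split; exact: lexx.
pose KK := `|K| + `|K'|.
have KKK : K <= KK by rewrite ler_wpDr // ler_norm.
have KKK' : K' <= KK by rewrite ler_wpDl // ler_norm.
have KKS : K' + K <= KK by rewrite addrC lerD // ler_norm.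
(* Along the section, both coord1 and the power y2 of coord2 are O(t^y1). *)
apply: (@tangent _ KK 1%N y2 y1 y1) => //; first exact: leq_ltn_trans y21.
move=> s sm; have [sd sr sr'] := mE s sm.
have [bA bB] := oAB s sr; have [bE bC] := oEC s sr'.
have sy0 : 0 <= `|s| ^+ y1 by exact: exprn_ge0.
have up (k : R) (z : C) : `|z| <= k%:C * `|s| ^+ y1 -> k <= KK ->
    `|z| <= KK%:C * `|s| ^+ y1.
  by move=> h kK; apply: le_trans h _; rewrite ler_wpM2r // lecR.
rewrite coord1_phi ?coord2_phi; [|exact: dm2|exact: dm2].
rewrite -line2 expr1; split.
  by case: (c1); [exact: (up K)|exact: (up K')].
have dx := dm2 s sm; rewrite -line2 in dx.
rewrite -normrX.
have -> : pT true (vec3 0 0 s) ^+ y2 = pE true (vec3 0 0 s) - pB true (vec3 0 0 s).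
  rewrite /pT /pE /pB (pulled_chartE gT dx) (pulled_chartE gE dx) (pulled_chartE gB dx).
  exact: coneT_pow.
apply: (up (K' + K)) => //.
by rewrite rmorphD mulrDl /=; apply: le_trans (ler_normB _ _) _; exact: lerD.
Qed.
End NotIsomorphic.

Lemma isomorphic_sym (R : realType) (m n : nat) (M : complexManifold R m)
  (N : complexManifold R n) : isomorphic M N -> isomorphic N M.
Proof. by move=> [f [g [hf hg fg gf]]]; exists g, f. Qed.

Lemma isomorphic_refl (R : realType) (n : nat) (M : complexManifold R n) :
  isomorphic M M.
Proof.
have hid : holomorphic (id : M -> M).
  by split=> [x //|i j p ip jp]; exact: transition_holomorphic.
by exists id, id.
Qed.

Theorem theorem1p13 (R : realType) :
  (forall y1 y2 : nat, (2 <= y1)%N -> (2 <= y2)%N ->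
     (isomorphic (calW2 R y1) (calW2 R y2) <-> y1 = y2)) /\
  infinite_set (range (@isomorphism_class R)).
Proof.
have classification (y1 y2 : nat) : (2 <= y1)%N -> (2 <= y2)%N ->
    (isomorphic (calW2 R y1) (calW2 R y2) <-> y1 = y2).
  move=> y12 y22; split=> [iso|->]; last exact: isomorphic_refl.
  case: (ltngtP y1 y2) => // lt.
  - case: (calW2_not_isomorphic _ lt (isomorphic_sym iso)).
    exact: ltn_trans y12.
  - case: (calW2_not_isomorphic _ lt iso).
    exact: ltn_trans y22.
split=> // fin.
apply: infinite_nat.
pose c (y : nat) := isomorphism_class (unit_parameter R y.+2).
rewrite (_ : [set: nat] = c @^-1` range (@isomorphism_class R)); last first.
  by apply/seteqP; split=> // y _; exists (unit_parameter R y.+2).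
apply: finite_preimage fin => y1 y2 _ _ cc.
have : c y2 (unit_parameter R y2.+2) by exact: isomorphic_refl.
rewrite -cc /c /isomorphism_class /= -!calW2E.
by move=> /classification => /(_ isT isT) [].
Qed.
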